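(* Let $1\leq k<d$ be integers, let $X$ be an isometric embedding of $[0,1]^k$ in $\mathbb{R}^d$ and let $\mu$ be the restriction of $k$-dimensional Hausdorff measure to $X$. Then \[ \dim_{\mathrm F}^{\theta}X=\dim_{\mathrm F}^{\theta}\mu=k\theta \] for all $\theta\in[0,1]$.
   Context: For a finite Borel measure $\mu$ on $\mathbb{R}^d$ write $\widehat\mu(z)=\int e^{-2\pi i z\cdot x}\,d\mu(x)$. For $s\geq 0$ and $\theta\in(0,1]$ let $\mathcal{J}_{s,\theta}(\mu)=\left(\int_{\mathbb{R}^d}|\widehat\mu(z)|^{2/\theta}|z|^{s/\theta-d}\,dz\right)^{\theta}$, and let $\mathcal{J}_{s,0}(\mu)=\sup_{z\in\mathbb{R}^d}|\widehat\mu(z)|^2|z|^s$. The Fourier spectrum of $\mu$ at $\theta\in[0,1]$ is $\dim_{\mathrm F}^{\theta}\mu=\sup\{s\geq 0:\mathcal{J}_{s,\theta}(\mu)<\infty\}$, with $\sup\emptyset=0$. For non-empty $X\subseteq\mathbb{R}^d$, $\dim_{\mathrm F}^{\theta}X=\sup\{\min\{\dim_{\mathrm F}^{\theta}\nu,d\}:\operatorname{spt}(\nu)\subseteq X\}$, where the supremum is over non-zero finite Borel measures $\nu$ on $\mathbb{R}^d$ whose (closed) support is contained in $X$. *)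

(* Defs.v *)
From HB Require Import structures.
From mathcomp Require Import all_boot all_order all_algebra.
From mathcomp Require Import complex.
From mathcomp Require Import all_classical all_reals all_analysis.

Set Implicit Arguments.
Unset Strict Implicit.
Unset Printing Implicit Defensive.

Import Order.TTheory GRing.Theory Num.Theory.
Import numFieldTopology.Exports numFieldNormedType.Exports.

Local Open Scope classical_set_scope.
Local Open Scope complex_scope.
Local Open Scope ring_scope.

(* The library norm on 'rV[R]_d is the sup norm; it induces the Euclidean
   topology, but lengths, distances and diameters need the Euclidean norm. *)
Definition dotrv (R : realType) (d : nat) (x y : 'rV[R]_d) : R :=
  \sum_(i < d) x 0 i * y 0 i.

Definition enorm (R : realType) (d : nat) (x : 'rV[R]_d) : R :=
  Num.sqrt (dotrv x x).

Definition unit_cube (R : realType) (k : nat) : set 'rV[R]_k :=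
  [set x | forall i : 'I_k, 0 <= x 0 i <= 1].

Definition isometric_on (R : realType) (k d : nat) (D : set 'rV[R]_k)
    (f : 'rV[R]_k -> 'rV[R]_d) : Prop :=
  forall x y, D x -> D y -> enorm (f x - f y) = enorm (x - y).

Definition borel (R : realType) (d : nat) : measurableType _ :=
  g_sigma_algebraType (@open 'rV[R]_d).

(* Iterated product of the one-dimensional Lebesgue measure on the product
   sigma-algebra of R^n; for n = 0 it is the unit mass at the empty tuple. *)
Fixpoint lebesgue_tuple (R : realType) (n : nat) :
    set (n.-tuple (measurableTypeR R)) -> \bar R :=
  match n return set (n.-tuple (measurableTypeR R)) -> \bar R with
  | 0 => \d_([tuple] : 0.-tuple (measurableTypeR R))
  | m.+1 => pushforward (@lebesgue_measure R \x @lebesgue_tuple R m)%E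
              (fun p : measurableTypeR R * m.-tuple (measurableTypeR R) =>
                 [tuple of p.1 :: p.2] : m.+1.-tuple (measurableTypeR R))
  end.

(* Lebesgue measure on the Borel sets of 'rV[R]_d, where the row
   (x_0, ..., x_(d-1)) is identified with the tuple of its entries. *)
Definition lebesgue_rV (R : realType) (d : nat) : set (borel R d) -> \bar R :=
  pushforward (@lebesgue_tuple R d)
    (fun t : d.-tuple (measurableTypeR R) =>
       (\row_(i < d) (tnth t i : R)) : borel R d).

Section hausdorff.
Local Open Scope ereal_scope.

Definition ediam (R : realType) (d : nat) (U : set 'rV[R]_d) : \bar R :=
  ereal_sup [set (enorm (p.1 - p.2))%:E | p in U `*` U].

(* The empty set is singled out since ediam set0 = -oo, and since 0 ^+ 0 = 1. *)
Definition hausdorff_gauge (R : realType) (k d : nat) (U : set 'rV[R]_d) :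
    \bar R :=
  if U == set0 then 0 else ediam U ^+ k.

Definition hausdorff_pre (R : realType) (k d : nat) (delta : R)
    (A : set 'rV[R]_d) : \bar R :=
  ereal_inf [set \sum_(0 <= i <oo) hausdorff_gauge k (U i) |
    U in [set U : nat -> set 'rV[R]_d |
      (forall i, ediam (U i) <= delta%:E) /\ A `<=` \bigcup_i U i]].

(* hausdorff_pre k delta A is nonincreasing in delta, so its limit as delta
   decreases to 0 is this supremum. *)
Definition hausdorff (R : realType) (k d : nat) (A : set 'rV[R]_d) : \bar R :=
  ereal_sup [set hausdorff_pre k delta A | delta in [set delta : R | (0 < delta)%R]].

Definition hausdorff_restr (R : realType) (k d : nat) (X : set 'rV[R]_d) :
    set (borel R d) -> \bar R :=
  fun A => hausdorff k (A `&` X).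

End hausdorff.

Definition integralC (R : realType) (d : nat) (mu : set (borel R d) -> \bar R)
    (f : borel R d -> R[i]) : R[i] :=
  fine (\int[mu]_x (complex.Re (f x))%:E)%E
    +i* fine (\int[mu]_x (complex.Im (f x))%:E)%E.

Definition expi (R : realType) (t : R) : R[i] := cos t +i* sin t.

Definition fourier (R : realType) (d : nat) (mu : set (borel R d) -> \bar R)
    (z : 'rV[R]_d) : R[i] :=
  integralC mu (fun x => expi (- (2 * pi * dotrv z x))).

(* The point z = 0, where 0 `^ r = 0 for r < 0, is Lebesgue-null when 0 < d;
   in the case theta = 0, s = 0 one has 0 `^ 0 = 1. *)
Definition energy (R : realType) (d : nat) (s theta : R)
    (mu : set (borel R d) -> \bar R) : \bar R :=
  if theta == 0 then
    ereal_sup [set (Normc.normc (fourier mu z) ^+ 2 * enorm z `^ s)%:E |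
                 z in [set: 'rV[R]_d]]
  else
    ((\int[@lebesgue_rV R d]_z
        (Normc.normc (fourier mu z) `^ (2 / theta)
           * enorm z `^ (s / theta - d%:R))%:E) `^ theta)%E.

(* Adjoining 0 implements the convention sup set0 = 0, and changes nothing
   otherwise since only s >= 0 are considered. *)
Definition fourier_spectrum (R : realType) (d : nat) (theta : R)
    (mu : set (borel R d) -> \bar R) : \bar R :=
  ereal_sup ([set 0%E] `|`
    [set s%:E | s in [set s : R | 0 <= s /\ (energy s theta mu < +oo)%E]]).

Definition spt (R : realType) (d : nat) (nu : set (borel R d) -> \bar R) :
    set 'rV[R]_d :=
  [set x | forall U : set 'rV[R]_d, open U -> U x -> (0 < nu U)%E].

Definition fourier_spectrum_set (R : realType) (d : nat) (theta : R)
    (X : set 'rV[R]_d) : \bar R :=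
  ereal_sup [set Order.min (fourier_spectrum theta nu) (d%:R)%:E |
    nu in [set nu : {finite_measure set (borel R d) -> \bar R} |
      nu [set: borel R d] != 0%E /\ spt nu `<=` X]].

(* Main.v *)
(* An isometric embedding of the cube is affine, x |-> b + x A with orthonormal
   rows, so mu is a constant multiple of the image of Lebesgue measure on the cube
   (Hausdorff measure on R^k is translation invariant) and |mu^(z)| depends only on
   u = z A^T: it is a constant times the product of the |sin(pi u_i) / (pi u_i)|.
   Completing A to an invertible matrix gives coordinates (u, v) on R^d, in which
   the integrand of the energy is dominated by
   |(u, v)|^(s/theta - d) prod_i max(1, |u_i|)^(-2/theta), integrable for
   0 < s < k theta. Conversely, for every nonzero nu supported in X, |nu^(z)| is
   bounded below as soon as u is small, uniformly in v, and on the region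
   |u| < delta, |v| ~ N the energy integral is at least of order
   N^(s/theta - d) N^(d - k), which is unbounded for s > k theta. *)
Require Import Defs.
From HB Require Import structures.
From mathcomp Require Import all_boot all_order all_algebra.
From mathcomp Require Import complex ring lra.
From mathcomp Require Import all_classical all_reals all_analysis.
From mathcomp Require Import measurable_realfun.

Set Implicit Arguments.
Unset Strict Implicit.
Unset Printing Implicit Defensive.

Import Order.TTheory GRing.Theory Num.Theory.
Import numFieldTopology.Exports numFieldNormedType.Exports.

Local Open Scope classical_set_scope.
Local Open Scope ring_scope.

(** * Borel sets of row vectors *)

(** Two constants are never computed: the ratio of Hausdorff to Lebesgue measure on R^k, and the
    Jacobian of the change of coordinates. Both come from one uniqueness statement for sigma-finite
    translation-invariant measures, so that it remains to see that a cube has positive finite mass.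
    For Hausdorff measure this presupposes countable additivity on Borel sets, hence Caratheodory's
    criterion. Complex integrals are bypassed too: transforms are read off from the real integrals
    of [1 + cos (psi + dotrv w x)]. The integrand is nonnegative, so Tonelli applies, and the free
    phase [psi] recovers both real and imaginary parts. Energy integrals are only compared with
    explicit functions; the comparison is between nonnegative integrands, so measurability of the
    transform in z never enters. The bound theta <= 1 is used as 2 / theta >= 2: quadratic decay in
    each u_i is already integrable. At theta = 0 the lower bound is the trivial one, and the upper
    bound follows the supremum along a direction with u = 0. *)

Lemma borel_open (R : realType) n (U : set 'rV[R]_n) :
  open U -> measurable (U : set (borel R n)).
Proof. by move=> oU; apply: sub_sigma_algebra. Qed.

Lemma borel_measurability (R : realType) n d (T : measurableType d)
    (f : T -> borel R n) :
  (forall U : set 'rV[R]_n, open U -> measurable (f @^-1` U)) ->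
  measurable_fun setT f.
Proof.
move=> h; have E : @measurable _ (borel R n) = <<s [set U | @open 'rV[R]_n U] >> by [].
apply: (measurability _ E).
by move=> _ [U oU <-]; rewrite setTI; exact: h.
Qed.

(** Countability of the index set is the point: it yields measurability from coordinates, and later
    the nullity of the complement of a support. *)
Lemma open_rV_ball (R : realType) n (U : set 'rV[R]_n) :
  open U -> U = \bigcup_(p : 'rV[rat]_n * nat)
    [set y | ball (map_mx ratr p.1 : 'rV[R]_n) p.2.+1%:R^-1 y /\
             ball (map_mx ratr p.1 : 'rV[R]_n) p.2.+1%:R^-1 `<=` U].
Proof.
move=> oU; apply/seteqP; split => [x Ux|y [p _ [py pU]]]; last exact: pU.
have [e /= e0 xeU] : nbhs_ball x U by apply/nbhs_ballP; exact: open_nbhs_nbhs.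
have /ltr_add_invr[m] : 0 < e / 2 by rewrite divr_gt0.
rewrite add0r => me.
have m0 : 0 < m.+1%:R^-1 :> R by rewrite invr_gt0.
have hq (i : 'I_n) : exists q : rat, `|ratr q - x 0 i| < m.+1%:R^-1.
  have [|q] := @rat_in_itvoo R (x 0 i - m.+1%:R^-1) (x 0 i + m.+1%:R^-1).
    by rewrite ltrD2l gtrN.
  by rewrite in_itv/= => hq; exists q; rewrite ltr_distl.
pose q : 'rV[rat]_n := \row_i (sval (cid (hq i))).
have qx : ball (map_mx ratr q : 'rV[R]_n) m.+1%:R^-1 x.
  split=> // i j; rewrite !mxE (ord1 i) /=.
  by case: (cid (hq j)).
exists (q, m) => //; split=> //= y qy; apply: xeU.
have : ball x (m.+1%:R^-1 + m.+1%:R^-1) y.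
  by apply: ball_triangle qy; apply: ball_sym.
by apply: le_ball; rewrite [leRHS]splitr; apply: lerD; exact: ltW.
Qed.

(** A ball of the sup norm is a finite intersection of coordinate conditions, and an open set is a
    countable union of such balls. *)
Lemma measurable_rowP (R : realType) n d (T : measurableType d)
    (f : T -> borel R n) :
  (forall i, measurable_fun setT (fun t => (f t : 'rV[R]_n) 0 i)) ->
  measurable_fun setT f.
Proof.
move=> mf; apply: borel_measurability => U oU.
rewrite (open_rV_ball oU) preimage_bigcup.
apply: countable_bigcupT_measurable => [|[q m]]; first exact: countableP.
have [qU|qU] := pselect (ball (map_mx ratr q : 'rV[R]_n) m.+1%:R^-1 `<=` U);
    last first.
  by rewrite [X in measurable X](_ : _ = set0)// -subset0 => t -[].
rewrite [X in measurable X](_ : _ =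
  \bigcap_(i in [set: 'I_n]) ((fun t => (f t : 'rV[R]_n) 0 i) @^-1`
     ball (ratr (q 0 i) : R) m.+1%:R^-1)); last first.
  apply/seteqP; split => [t [[_ qt] _] i _|t ht] /=.
    by have := qt 0 i; rewrite mxE.
  by split=> //; split=> // i j; rewrite (ord1 i) mxE; apply: ht.
apply: fin_bigcap_measurable => // i _.
rewrite -[X in measurable X]setTI.
apply: mf => //; apply: open_measurable.
by apply: ball_open; rewrite invr_gt0.
Qed.

Lemma measurable_rV_continuous (R : realType) n (f : 'rV[R]_n -> R) :
  continuous f -> measurable_fun setT (f : borel R n -> R).
Proof.
move=> cf; apply: (measurability _ (RGenOpens.measurableE R)).
move=> _ [_ [x [y ->]] <-]; rewrite setTI; apply: borel_open.
by move/continuousP : cf; apply; exact: interval_open.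
Qed.

Lemma measurable_coord (R : realType) n (i : 'I_n) :
  measurable_fun setT (fun x : borel R n => (x : 'rV[R]_n) 0 i).
Proof. by apply: measurable_rV_continuous => x; exact: coord_continuous. Qed.

Lemma measurable_fun_coord (R : realType) n d (T : measurableType d)
    (f : T -> borel R n) (i : 'I_n) : measurable_fun setT f ->
  measurable_fun setT (fun t => (f t : 'rV[R]_n) 0 i).
Proof. by move=> mf; exact: (measurableT_comp (@measurable_coord R n i) mf). Qed.

Lemma measurable_mulmx (R : realType) m n (A : 'M[R]_(m, n)) :
  measurable_fun setT ((fun x : 'rV[R]_m => x *m A) : borel R m -> borel R n).
Proof.
apply: measurable_rowP => j; under eq_fun do rewrite mxE.
apply: measurable_sum => i; apply: measurable_funM => //.
exact: measurable_coord.
Qed.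

Lemma measurable_addrV (R : realType) n d (T : measurableType d)
    (f g : T -> borel R n) : measurable_fun setT f -> measurable_fun setT g ->
  measurable_fun setT ((fun t => (f t : 'rV[R]_n) + g t) : T -> borel R n).
Proof.
move=> mf mg; apply: measurable_rowP => i; under eq_fun do rewrite mxE.
by apply: measurable_funD; exact: measurable_fun_coord.
Qed.

Lemma measurable_opprV (R : realType) n d (T : measurableType d)
    (f : T -> borel R n) : measurable_fun setT f ->
  measurable_fun setT ((fun t => - (f t : 'rV[R]_n)) : T -> borel R n).
Proof.
move=> mf; apply: measurable_rowP => i; under eq_fun do rewrite mxE.
by apply: measurableT_comp => //; exact: measurable_fun_coord.
Qed.

(** * Lebesgue measure on row vectors *)

Lemma measurable_tuple_cons (R : realType) n :
  measurable_fun setT (fun p : measurableTypeR R * n.-tuple (measurableTypeR R) =>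
    [tuple of p.1 :: p.2] : n.+1.-tuple (measurableTypeR R)).
Proof. by apply: measurable_cons. Qed.

Lemma measurable_tuple_behead (R : realType) n :
  measurable_fun setT (fun t : n.+1.-tuple (measurableTypeR R) =>
    [tuple of behead t] : n.-tuple (measurableTypeR R)).
Proof.
apply/measurable_fun_tnthP => i.
rewrite (_ : _ \o _ = fun t : n.+1.-tuple (measurableTypeR R) => tnth t (lift ord0 i)).
  exact: measurable_tnth.
apply/funext => t /=; rewrite tnth_behead; congr tnth; apply/val_inj.
by rewrite /= inordK ?ltnS.
Qed.

Lemma pushforward_sigma_finite (R : realType) d1 d2 (T1 : measurableType d1)
    (T2 : measurableType d2) (m : {measure set T1 -> \bar R})
    (f : T1 -> T2) (g : T2 -> T1) : sigma_finite setT m ->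
  measurable_fun setT f -> measurable_fun setT g -> cancel f g ->
  exists P : {sigma_finite_measure set T2 -> \bar R},
    (P : set T2 -> \bar R) = pushforward m f.
Proof.
move=> [F FT mF] mf mg fK.
pose ph : {mfun _ >-> _} := HB.pack f (isMeasurableFun.Build _ _ _ _ _ mf).
pose M := pushforward m ph.
have sM : sigma_finite setT M.
  exists (fun i => g @^-1` F i); first by rewrite -preimage_bigcup -FT.
  move=> i; split.
    by rewrite -[X in measurable X]setTI; apply: mg => //; have [] := mF i.
  rewrite /M /pushforward -comp_preimage.
  rewrite (_ : g \o ph = id) ?preimage_id; first by have [] := mF i.
  by apply/funext => p; exact: fK.
pose P : {sigma_finite_measure set _ -> \bar R} :=
  HB.pack M (Measure_isSigmaFinite.Build _ _ _ M sM).
by exists (P mf mf mf).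
Qed.

Lemma product_sigma_finite (R : realType) d1 d2 (T1 : measurableType d1)
    (T2 : measurableType d2) (m1 : {sigma_finite_measure set T1 -> \bar R})
    (m2 : {sigma_finite_measure set T2 -> \bar R}) :
  sigma_finite setT (m1 \x m2)%E.
Proof.
have /sigma_finiteP[F [FT ndF mF]] := sigma_finiteT m1.
have /sigma_finiteP[G [GT ndG mG]] := sigma_finiteT m2.
exists (fun i => F i `*` G i) => [|i].
  apply/seteqP; split=> // -[x y] _.
  have [i _ Fi] : (\bigcup_i F i) x by rewrite -FT.
  have [j _ Gj] : (\bigcup_i G i) y by rewrite -GT.
  exists (maxn i j) => //; split.
  - by move: Fi; apply/subsetPset/ndF/leq_maxl.
  - by move: Gj; apply/subsetPset/ndG/leq_maxr.
have [mFi Fioo] := mF i; have [mGi Gioo] := mG i.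
split; first exact: measurableX.
by rewrite product_measure1E// lte_mul_pinfty// ge0_fin_numE.
Qed.

Lemma lebesgue_tuple_measure (R : realType) n :
  exists m : {sigma_finite_measure set (n.-tuple (measurableTypeR R)) -> \bar R},
    (m : set _ -> \bar R) = @lebesgue_tuple R n.
Proof.
elim: n => [|n [m mE]].
  by exists (dirac ([tuple] : 0.-tuple (measurableTypeR R))).
rewrite /= -mE.
apply: (@pushforward_sigma_finite _ _ _ _ _ _ _
  (fun t : n.+1.-tuple (measurableTypeR R) => (thead t, [tuple of behead t]))).
- exact: product_sigma_finite.
- exact: measurable_tuple_cons.
- apply/measurable_fun_pairP; split; first exact: measurable_tnth.
  exact: measurable_tuple_behead.
- by case=> x t; rewrite /= theadE; congr pair; exact: val_inj.
Qed.

(** [lebesgue_tuple] is a bare set function; this bundled copy carries the sigma-finite structure on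
    which Tonelli relies. *)
Definition ltuple (R : realType) n :
    {sigma_finite_measure set (n.-tuple (measurableTypeR R)) -> \bar R} :=
  sval (cid (lebesgue_tuple_measure R n)).

Lemma ltupleE (R : realType) n :
  (@ltuple R n : set _ -> \bar R) = @lebesgue_tuple R n.
Proof. by rewrite /ltuple; case: cid. Qed.

Lemma ge0_integral_ltuple0 (R : realType)
    (f : 0.-tuple (measurableTypeR R) -> \bar R) :
  measurable_fun setT f ->
  (\int[ltuple R 0]_t f t = f [tuple])%E.
Proof. by move=> mf; rewrite ltupleE /= integral_dirac// diracT mul1e. Qed.

Lemma ge0_integral_ltupleS (R : realType) n
    (f : n.+1.-tuple (measurableTypeR R) -> \bar R) :
  measurable_fun setT f -> (forall t, 0 <= f t)%E ->
  (\int[ltuple R n.+1]_t f t =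
   \int[lebesgue_measure]_x \int[ltuple R n]_t f [tuple of x :: t])%E.
Proof.
move=> mf f0; rewrite ltupleE /= -ltupleE.
rewrite ge0_integral_pushforward//; last exact: measurable_tuple_cons.
rewrite preimage_setT fubini_tonelli1//.
  exact: (measurableT_comp mf (@measurable_tuple_cons R n)).
by move=> p; exact: f0.
Qed.

Lemma measurable_row_tnth (R : realType) n :
  measurable_fun setT (fun t : n.-tuple (measurableTypeR R) =>
    (\row_(i < n) (tnth t i : R)) : borel R n).
Proof.
apply: measurable_rowP => i; under eq_fun do rewrite mxE.
exact: measurable_tnth.
Qed.

Lemma lebesgue_rV_measure (R : realType) n :
  exists m : {sigma_finite_measure set (borel R n) -> \bar R},
    (m : set _ -> \bar R) = @lebesgue_rV R n.
Proof.
rewrite /lebesgue_rV -ltupleE.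
apply: (@pushforward_sigma_finite _ _ _ _ _ _ _
  (fun x : borel R n => [tuple (x : 'rV[R]_n) 0 i : measurableTypeR R | i < n])).
- exact: sigma_finiteT.
- exact: measurable_row_tnth.
- apply/measurable_fun_tnthP => i.
  rewrite (_ : _ \o _ = (fun x : borel R n => (x : 'rV[R]_n) 0 i)).
    exact: measurable_coord.
  by apply/funext => x /=; rewrite tnth_mktuple.
- by move=> t; apply: eq_from_tnth => i; rewrite tnth_mktuple mxE.
Qed.

Definition lrV (R : realType) n : {sigma_finite_measure set (borel R n) -> \bar R} :=
  sval (cid (lebesgue_rV_measure R n)).

Lemma lrVE (R : realType) n : (@lrV R n : set _ -> \bar R) = @lebesgue_rV R n.
Proof. by rewrite /lrV; case: cid. Qed.

Lemma ge0_integral_lrV (R : realType) n (f : borel R n -> \bar R) :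
  measurable_fun setT f -> (forall t, 0 <= f t)%E ->
  (\int[lrV R n]_x f x = \int[ltuple R n]_t f (\row_(i < n) tnth t i))%E.
Proof.
move=> mf f0; rewrite lrVE /lebesgue_rV -ltupleE.
by rewrite ge0_integral_pushforward//; exact: measurable_row_tnth.
Qed.

(** Up to the phase e^(iu/2), the integral of e^(iux) over [0, 1]; the value at 0 is the continuous
    extension. *)
Definition sinc (R : realType) (u : R) : R :=
  if u == 0 then 1 else sin (u / 2) / (u / 2).

(** The form [1 + P * cos] is stable under integrating out one coordinate after another: [P]
    accumulates the sinc factors and [psi] the phase. *)
Lemma integral_cos01 (R : realType) (u psi P : R) :
  (\int[lebesgue_measure]_(x in `[0%R, 1%R]) (1 + P * cos (psi + u * x))%:E =
   (1 + P * sinc u * cos (psi + u / 2))%:E)%E.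
Proof.
pose f (x : R) := 1 + P * cos (psi + u * x).
pose F (x : R) := if u == 0 then x + P * cos psi * x
                  else x + P * (sin (psi + u * x) / u).
have dF (x : R) : is_derive x (1:R) F (f x).
  rewrite /F /f; have [->|u0] := eqVneq u 0.
    by apply: is_derive_eq; rewrite /GRing.scale/= mul0r addr0 !mulr1.
  apply: is_derive_eq; rewrite /GRing.scale/=; field.
  exact: u0.
rewrite (@continuous_FTC2 _ f F)//.
- rewrite -EFinB; congr EFin; rewrite /F /sinc.
  have [->|u0] := eqVneq u 0; first by rewrite mul0r addr0; ring.
  rewrite mulr0 mulr1 addr0.
  (* Centring at the midpoint phase [psi + u / 2] makes the difference of sines equal to 2 cos (psi
     + u/2) sin (u/2). *)
  have -> : sin (psi + u) = sin (psi + u / 2 + u / 2).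
    by congr sin; rewrite -addrA -splitr.
  have -> : sin psi = sin (psi + u / 2 - u / 2) by rewrite addrK.
  rewrite sinB sinD; field.
  exact: u0.
- apply: continuous_subspaceT => x; rewrite /f.
  apply: cvgD; first exact: cvg_cst.
  apply: cvgM; first exact: cvg_cst.
  apply: (@cvg_comp _ _ _ (fun x => psi + u * x) cos _ (nbhs (psi + u * x))).
    by apply: cvgD; [exact: cvg_cst|apply: cvgM; [exact: cvg_cst|exact: cvg_id]].
  exact: continuous_cos.
- have cF x : {for x, continuous F}.
    by apply: differentiable_continuous; apply/derivable1_diffP; have [] := dF x.
  split.
  + by move=> x _; have [] := dF x.
  + exact/cvg_at_right_filter/cF.
  + exact/cvg_at_left_filter/cF.
- by move=> x _; rewrite derive1E; have [_ ->] := dF x.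
Qed.

Lemma ge0_integral_lebesgue_shift (R : realType) (a : R) (f : R -> \bar R) :
  measurable_fun setT f -> (forall x, 0 <= f x)%E ->
  (\int[@lebesgue_measure R]_x f ((x : R) + a)%R = \int[@lebesgue_measure R]_x f x)%E.
Proof.
move=> mf f0.
have ma : measurable_fun setT (fun x : measurableTypeR R => x + a : measurableTypeR R).
  exact: measurable_funD.
pose ph : {mfun _ >-> _} := HB.pack (fun x : measurableTypeR R => x + a : measurableTypeR R)
  (isMeasurableFun.Build _ _ _ _ _ ma).
transitivity (\int[pushforward (@lebesgue_measure R) ph]_x f x)%E.
  by rewrite ge0_integral_pushforward.
apply: eq_measure_integral => A mA _; apply/esym.
pose M : {measure set (measurableTypeR R) -> \bar R} := pushforward (@lebesgue_measure R) ph.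
apply: (@lebesgue_measure_unique R (M ma)) => // _ [[x y] _ <-] /=.
rewrite /M /= /pushforward.
rewrite (_ : ph @^-1` _ = `]x - a, y - a]%classic).
  rewrite !lebesgue_measure_itv/= !lte_fin ltrD2r.
  by case: ifP => // _; rewrite -!EFinD; congr EFin; ring.
by apply/seteqP; split => z /=; rewrite !in_itv/= ltrBlDr lerBrDr.
Qed.

Lemma ge0_integral_ltuple_prod (R : realType) n (g : 'I_n -> R -> R) :
  (forall i, measurable_fun setT (g i)) -> (forall i x, 0 <= g i x) ->
  (\int[ltuple R n]_t (\prod_(i < n) g i (tnth t i))%:E =
   \prod_(i < n) \int[@lebesgue_measure R]_x (g i x)%:E)%E.
Proof.
elim: n g => [|n ih] g mg g0.
  under eq_integral do rewrite big_ord0.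
  by rewrite ge0_integral_ltuple0 ?big_ord0.
have mprod m (h : 'I_m -> R -> R) : (forall i, measurable_fun setT (h i)) ->
    measurable_fun setT (fun t : m.-tuple (measurableTypeR R) =>
      (\prod_(i < m) h i (tnth t i))%:E).
  move=> mh; apply/measurable_EFinP; apply: measurable_prod => i _.
  exact: (measurableT_comp (mh i) (@measurable_tnth _ _ _ i)).
rewrite ge0_integral_ltupleS//; last 2 first.
- exact: mprod.
- by move=> t; rewrite lee_fin prodr_ge0.
rewrite big_ord_recl -ih//.
set C := (X in (_ * X)%E).
have C0 : (0 <= C)%E by apply: integral_ge0 => t _; rewrite lee_fin prodr_ge0.
rewrite -ge0_integralZr//; last by move=> x _; rewrite lee_fin.
  apply: eq_integral => x _.
  have m' := mprod _ (fun i => g (lift ord0 i)) (fun i => mg _).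
  rewrite /C -(ge0_integralZl _ _ m')//; last 2 first.
  - by move=> t _; rewrite lee_fin prodr_ge0.
  - by rewrite lee_fin.
  apply: eq_integral => t _; rewrite -EFinM; congr EFin.
  rewrite big_ord_recl; congr (_ * _).
  by apply: eq_bigr => i _; rewrite tnthS.
by apply/measurable_EFinP; exact: mg.
Qed.

Lemma measurable_prod_coord (R : realType) n (g : 'I_n -> R -> R) :
  (forall i, measurable_fun setT (g i)) ->
  measurable_fun setT (fun x : borel R n => (\prod_(i < n) g i ((x : 'rV[R]_n) 0 i))).
Proof.
move=> mg; apply: measurable_prod => i _.
exact: (measurableT_comp (mg i) (@measurable_coord R n i)).
Qed.

Lemma ge0_integral_lrV_prod (R : realType) n (g : 'I_n -> R -> R) :
  (forall i, measurable_fun setT (g i)) -> (forall i x, 0 <= g i x) ->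
  (\int[lrV R n]_x (\prod_(i < n) g i ((x : 'rV[R]_n) 0 i))%:E =
   \prod_(i < n) \int[@lebesgue_measure R]_x (g i x)%:E)%E.
Proof.
move=> mg g0; rewrite ge0_integral_lrV.
- rewrite -ge0_integral_ltuple_prod//.
  apply: eq_integral => t _; congr EFin.
  by apply: eq_bigr => i _; rewrite mxE.
- by apply/measurable_EFinP; exact: measurable_prod_coord.
- by move=> x; rewrite lee_fin prodr_ge0.
Qed.

(** * Translation invariance of Lebesgue measure, boxes, and cosine integrals over the cube *)

Lemma ge0_integral_ltuple_shift (R : realType) n (a : 'I_n -> R)
    (f : n.-tuple (measurableTypeR R) -> \bar R) :
  measurable_fun setT f -> (forall t, 0 <= f t)%E ->
  (\int[ltuple R n]_t f [tuple ((tnth t i : R) + a i)%R : measurableTypeR R | i < n] =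
   \int[ltuple R n]_t f t)%E.
Proof.
have mshift m (b : 'I_m -> R) : measurable_fun setT
    (fun t : m.-tuple (measurableTypeR R) =>
      [tuple (tnth t i : R) + b i : measurableTypeR R | i < m]).
  apply/measurable_fun_tnthP => i.
  rewrite (_ : _ \o _ = fun t : m.-tuple (measurableTypeR R) => (tnth t i : R) + b i).
    by apply: measurable_funD => //; exact: measurable_tnth.
  by apply/funext => t /=; rewrite tnth_mktuple.
elim: n a f => [|n ih] a f mf f0.
  apply: eq_integral => t _; congr f.
  by rewrite tuple0; apply/esym; rewrite [LHS]tuple0.
rewrite !ge0_integral_ltupleS//; last exact: (measurableT_comp mf (mshift _ _)).
pose G (x : R) := (\int[ltuple R n]_t f [tuple of (x : measurableTypeR R) :: t])%E.
have mfc x : measurable_fun setT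
    (fun t : n.-tuple (measurableTypeR R) => f [tuple of (x : measurableTypeR R) :: t]).
  apply: (measurableT_comp mf).
  by apply: measurable_cons => //; exact: measurable_cst.
transitivity (\int[@lebesgue_measure R]_x G ((x : R) + a ord0)%R)%E.
  apply: eq_integral => x _; rewrite /G -[RHS](ih (fun i => a (lift ord0 i)))//.
  apply: eq_integral => t _; congr f; apply: eq_from_tnth => i.
  rewrite tnth_mktuple; case: (unliftP ord0 i) => [j ->|->].
    by rewrite !tnthS tnth_mktuple.
  by rewrite !tnth0.
rewrite ge0_integral_lebesgue_shift//.
- have mF : measurable_fun setT
    (fun p : measurableTypeR R * n.-tuple (measurableTypeR R) => f [tuple of p.1 :: p.2]).
    exact: (measurableT_comp mf (@measurable_tuple_cons R n)).
  by apply: (@measurable_fun_fubini_tonelli_F _ _ _ _ _ (ltuple R n) _ mF).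
- by move=> x; exact: integral_ge0.
Qed.

Definition transl_inv (R : realType) n (m : set (borel R n) -> \bar R) :=
  forall (a : 'rV[R]_n) (E : set (borel R n)), measurable E ->
    m ((fun x : 'rV[R]_n => x + a) @^-1` E) = m E.

Lemma measurable_shift_preimage (R : realType) n (a : 'rV[R]_n) (E : set (borel R n)) :
  measurable E -> measurable ((fun x : 'rV[R]_n => x + a) @^-1` E : set (borel R n)).
Proof.
move=> mE; rewrite -[X in measurable X]setTI.
by apply: (@measurable_addrV _ _ _ _ (fun x : borel R n => x) (fun=> a)).
Qed.

Lemma lrV_transl_inv (R : realType) n : transl_inv (lrV R n).
Proof.
move=> a E mE.
have mE' := @measurable_shift_preimage _ _ a _ mE.
have lE (A : set (borel R n)) : measurable A ->
    lrV R n A = (\int[lrV R n]_x (\1_A x)%:E)%E.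
  by move=> mA; rewrite integral_indic// setIT.
rewrite !lE//.
have mI (A : set (borel R n)) : measurable A ->
    measurable_fun setT (fun x : borel R n => (\1_A x : R)%:E).
  by move=> mA; exact/measurable_EFinP.
rewrite !ge0_integral_lrV//; try exact: mI.
rewrite -[RHS](ge0_integral_ltuple_shift (fun i => a 0 i))//; last first.
  exact: (measurableT_comp (mI _ mE) (@measurable_row_tnth R n)).
apply: eq_integral => t _; congr EFin; rewrite !indicE.
have -> : \row_(i < n) (tnth [tuple ((tnth t i : R) + a 0 i)%R : measurableTypeR R
    | i < n] i : R) = \row_(i < n) (tnth t i : R) + a :> 'rV[R]_n.
  by apply/rowP => i; rewrite !mxE tnth_mktuple.
by [].
Qed.

Lemma integral_indicT (R : realType) d (T : measurableType d)
    (mu : {measure set T -> \bar R}) (A : set T) : measurable A ->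
  (\int[mu]_x (\1_A x)%:E = mu A)%E.
Proof. by move=> mA; rewrite integral_indic// setIT. Qed.

Definition rectV (R : realType) n (A : 'I_n -> set R) : set (borel R n) :=
  [set x | forall i, A i ((x : 'rV[R]_n) 0 i)].

Lemma measurable_rectV (R : realType) n (A : 'I_n -> set R) :
  (forall i, measurable (A i)) -> measurable (rectV A).
Proof.
move=> mA; rewrite (_ : rectV A = \bigcap_(i in [set: 'I_n])
  ((fun x : borel R n => (x : 'rV[R]_n) 0 i) @^-1` A i)); last first.
  by apply/seteqP; split=> x /= h i; [move=> _|]; exact: h.
apply: fin_bigcap_measurable => // i _; rewrite -[X in measurable X]setTI.
exact: measurable_coord.
Qed.

Lemma indic_rectV (R : realType) n (A : 'I_n -> set R) (x : borel R n) :
  \1_(rectV A) x = \prod_(i < n) \1_(A i) ((x : 'rV[R]_n) 0 i) :> R.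
Proof.
rewrite indicE; have [xA|xA] := boolP (x \in rectV A).
  rewrite big1// => i _; rewrite indicE mem_set//.
  by move: xA; rewrite inE; exact.
have /existsNP[i Ai] : ~ forall i, A i ((x : 'rV[R]_n) 0 i).
  by move=> h; move/negP : xA; apply; rewrite inE.
by rewrite (bigD1 i)//= indicE memNset// mul0r.
Qed.

Lemma lrV_rectV (R : realType) n (A : 'I_n -> set R) :
  (forall i, measurable (A i)) ->
  (lrV R n (rectV A) = \prod_(i < n) @lebesgue_measure R (A i))%E.
Proof.
move=> mA; rewrite -integral_indicT; last exact: measurable_rectV.
under eq_integral do rewrite indic_rectV.
rewrite (@ge0_integral_lrV_prod _ _ (fun i => \1_(A i)))//.
apply: eq_bigr => i _.
exact: (@integral_indicT _ _ _ (@lebesgue_measure R) (A i) (mA i)).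
Qed.

Lemma lrV_box (R : realType) n (a b : 'I_n -> R) : (forall i, a i <= b i) ->
  (lrV R n (rectV (fun i => `[a i, b i]%classic)) = (\prod_(i < n) (b i - a i))%:E)%E.
Proof.
move=> ab; rewrite lrV_rectV//.
rewrite -prodEFin; apply: eq_bigr => i _; rewrite lebesgue_measure_itv/= lte_fin.
by case: ltgtP (ab i) => // -> _; rewrite subrr.
Qed.

Lemma unit_cubeE (R : realType) n :
  @unit_cube R n = rectV (fun i => `[0%R, 1%R]%classic).
Proof. by apply/seteqP; split=> x /= h i; have := h i; rewrite /= in_itv. Qed.

Lemma measurable_unit_cube (R : realType) n :
  measurable (@unit_cube R n : set (borel R n)).
Proof. by rewrite unit_cubeE; exact: measurable_rectV. Qed.

Lemma lrV_unit_cube (R : realType) n : lrV R n (@unit_cube R n) = 1%E.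
Proof.
by rewrite unit_cubeE lrV_box// big1// => i _; rewrite subr0.
Qed.

(** The arbitrary phase lets the induction close: for a fixed first coordinate x, the term
    [u ord0 * x] is absorbed into [phi] before the remaining coordinates are integrated. *)
Lemma integral_cos_ltuple (R : realType) n (u : 'I_n -> R) (phi : R) :
  (\int[ltuple R n]_t ((\prod_(i < n) \1_(`[0%R, 1%R]%classic) (tnth t i)) *
      (1 + cos (phi + \sum_(i < n) u i * tnth t i)))%:E =
   (1 + (\prod_(i < n) sinc (u i)) * cos (phi + \sum_(i < n) u i / 2))%:E)%E.
Proof.
have mg m (v : 'I_m -> R) psi : measurable_fun setT
    (fun t : m.-tuple (measurableTypeR R) =>
     ((\prod_(i < m) \1_(`[0%R, 1%R]%classic) (tnth t i)) *
      (1 + cos (psi + \sum_(i < m) v i * tnth t i)))%:E).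
  apply/measurable_EFinP; apply: measurable_funM.
    apply: measurable_prod => i _.
    apply: (@measurableT_comp _ _ _ _ _ _ (\1_(`[0%R, 1%R]%classic : set R) : R -> R)) => //.
    exact: measurable_tnth.
  apply: measurable_funD => //.
  apply: measurableT_comp; first by apply: continuous_measurable_fun; exact: continuous_cos.
  apply: measurable_funD => //; apply: measurable_sum => i.
  by apply: measurable_funM => //; exact: measurable_tnth.
have g0 m (v : 'I_m -> R) psi (t : m.-tuple (measurableTypeR R)) :
     (0 <= ((\prod_(i < m) \1_(`[0%R, 1%R]%classic) (tnth t i)) *
      (1 + cos (psi + \sum_(i < m) v i * tnth t i)))%:E)%E.
  rewrite lee_fin; apply: mulr_ge0; first exact: prodr_ge0.
  by have := cos_geN1 (psi + \sum_(i < m) v i * tnth t i); lra.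
elim: n u phi => [|n ih] u phi.
  rewrite ge0_integral_ltuple0//.
  by rewrite !big_ord0 !mul1r.
rewrite ge0_integral_ltupleS//.
pose P := \prod_(i < n) sinc (u (lift ord0 i)).
pose S := \sum_(i < n) u (lift ord0 i) / 2.
transitivity (\int[@lebesgue_measure R]_(x in `[0%R, 1%R])
    (1 + P * cos ((phi + S) + u ord0 * x))%:E)%E.
  rewrite [RHS]integral_mkcond; apply: eq_integral => x _.
  rewrite /patch; have [x01|x01] := boolP (_ \in _); last first.
    rewrite integral0_eq// => t _.
    by rewrite big_ord_recl indicE tnth0 (negbTE x01) mul0r mul0r.
  rewrite (_ : phi + S + _ = (phi + u ord0 * (x : R)) + S); last by rewrite addrAC.
  rewrite -(ih (fun i => u (lift ord0 i))).
  apply: eq_integral => t _; congr EFin.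
  rewrite !big_ord_recl indicE tnth0 x01 mul1r addrA.
  congr (_ * (1 + cos (_ + _))).
    by apply: eq_bigr => i _; rewrite tnthS.
  by apply: eq_bigr => i _; rewrite tnthS.
rewrite integral_cos01 !big_ord_recl; congr (_%:E).
rewrite [sinc _ * _]mulrC; congr (1 + _ * cos _).
by rewrite -addrA; congr (_ + _); rewrite addrC.
Qed.

(** * Translation-invariant measures and linear changes of variables *)

Lemma integral_section_swap (R : realType) d1 d2 (T1 : measurableType d1)
    (T2 : measurableType d2) (m1 : {sigma_finite_measure set T1 -> \bar R})
    (m2 : {sigma_finite_measure set T2 -> \bar R}) (A : set (T1 * T2)) :
  measurable A ->
  (\int[m1]_x m2 [set y | A (x, y)] = \int[m2]_y m1 [set x | A (x, y)])%E.
Proof.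
move=> mA; have := indic_fubini_tonelli m1 m2 mA.
rewrite indic_fubini_tonelli_FE// indic_fubini_tonelli_GE//.
have -> : (m2 \o xsection A) = (fun x => m2 [set y | A (x, y)]).
  by apply/funext => x /=; congr (m2 _); apply/seteqP; split=> y /=; rewrite /xsection/= inE.
have -> // : (m1 \o ysection A) = (fun y => m1 [set x | A (x, y)]).
by apply/funext => y /=; congr (m1 _); apply/seteqP; split=> x /=; rewrite /ysection/= inE.
Qed.

Lemma integral_restr_cst (R : realType) d (T : measurableType d)
    (m : {measure set T -> \bar R}) (Q : set T) (c : \bar R) :
  measurable Q -> (0 <= c)%E ->
  (\int[m]_y (if y \in Q then c else 0) = c * m Q)%E.
Proof.
move=> mQ c0; rewrite -integral_cst// [RHS]integral_mkcond.
by apply: eq_integral => y _; rewrite /patch; case: ifP.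
Qed.

(* Both sides equal the m1 x m2 measure of [set (x, y) | x + y in E, y in Q],
   computed by slicing in either order. *)
Lemma transl_inv_unique (R : realType) n
    (m1 m2 : {sigma_finite_measure set (borel R n) -> \bar R})
    (E Q : set (borel R n)) :
  transl_inv m1 -> transl_inv m2 -> measurable E -> measurable Q ->
  (m1 E * m2 Q = m1 [set x | Q (- (x : 'rV[R]_n))%R] * m2 E)%E.
Proof.
move=> t1 t2 mE mQ.
have mpre (h : borel R n * borel R n -> borel R n) (S : set (borel R n)) :
    measurable_fun setT h -> measurable S -> measurable (h @^-1` S).
  by move=> mh mS; rewrite -[X in measurable X]setTI; exact: mh.
pose A := [set p : borel R n * borel R n | E ((p.1 : 'rV[R]_n) + p.2) /\ Q p.2].
pose B := [set p : borel R n * borel R n | E p.2 /\ Q ((p.2 : 'rV[R]_n) - p.1)].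
have mA : measurable A.
  apply: measurableI; last exact: (mpre snd).
  by apply: (mpre (fun p => (p.1 : 'rV[R]_n) + p.2)) => //; exact: measurable_addrV.
have mB : measurable B.
  apply: measurableI; first exact: (mpre snd).
  apply: (mpre (fun p => (p.2 : 'rV[R]_n) - p.1)) => //.
  by apply: measurable_addrV => //; exact: measurable_opprV.
have mNQ : measurable ([set x | Q (- (x : 'rV[R]_n))%R] : set (borel R n)).
  have mN := @measurable_opprV R n _ _ (fun x : borel R n => x) (@measurable_id _ _ _).
  by rewrite -[X in measurable X]setTI; exact: mN.
have -> : (m1 E * m2 Q = \int[m2]_y m1 [set x | A (x, y)])%E.
  rewrite -integral_restr_cst//.
  apply: eq_integral => y _; rewrite /A/=; case: ifPn => yQ.
    rewrite -(t1 y)//; congr (m1 _); apply/seteqP; split => x /=.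
      by move: yQ; rewrite inE.
    by case.
  rewrite [X in m1 X](_ : _ = set0) ?measure0//.
  by apply/seteqP; split => x //= -[_ Qy]; move: yQ; rewrite notin_setE.
rewrite -integral_section_swap//.
(* For fixed x, translating y by x turns the slice of [A] into the slice of [B]; this is where
   invariance of [m2] is used. *)
have -> : (\int[m1]_x m2 [set y | A (x, y)] = \int[m1]_x m2 [set y | B (x, y)])%E.
  apply: eq_integral => x _.
  have mBx : measurable ([set y | B (x, y)] : set (borel R n)).
    rewrite (_ : [set y | B (x, y)] = xsection B x); first exact: measurable_xsection.
    by apply/seteqP; split=> y /=; rewrite /xsection/= inE.
  rewrite -(t2 x _ mBx); congr (m2 _).
  by apply/seteqP; split => y /=; rewrite /A /B /= addrK addrC.
rewrite integral_section_swap//.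
rewrite -integral_restr_cst//.
apply: eq_integral => y _; rewrite /B/=; case: ifPn => yE.
  rewrite -(t1 (- y) _ mNQ); congr (m1 _); apply/seteqP; split => x /=.
    by case=> _; rewrite opprD opprK addrC.
  by rewrite opprD opprK addrC => ?; split=> //; move: yE; rewrite inE.
rewrite [X in m1 X](_ : _ = set0) ?measure0//.
by apply/seteqP; split => x //= -[Ey _]; move: yE; rewrite notin_setE.
Qed.

(** Testing uniqueness against the unit cube, of Lebesgue measure 1, makes the proportionality
    constant explicit: the mass of the reflected cube. *)
Lemma transl_inv_lrV (R : realType) n
    (m : {sigma_finite_measure set (borel R n) -> \bar R}) (E : set (borel R n)) :
  transl_inv m -> measurable E ->
  (m E = m [set x | @unit_cube R n (- (x : 'rV[R]_n))%R] * lrV R n E)%E.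
Proof.
move=> tm mE.
have := transl_inv_unique tm (@lrV_transl_inv R n) mE (@measurable_unit_cube R n).
by rewrite lrV_unit_cube mule1.
Qed.

Lemma ge0_integral_scaled_measure (R : realType) d (T : measurableType d)
    (m1 m2 : {measure set T -> \bar R}) (c : R) (f : T -> \bar R) : 0 <= c ->
  (forall A, measurable A -> m1 A = c%:E * m2 A)%E ->
  measurable_fun setT f -> (forall x, 0 <= f x)%E ->
  (\int[m1]_x f x = c%:E * \int[m2]_x f x)%E.
Proof.
move=> c0 m12 mf f0; rewrite -(ge0_integral_mscale _ _ (NngNum c0))//.
by apply: eq_measure_integral => A mA _; rewrite m12.
Qed.

(** The image of Lebesgue measure under [M] is again translation invariant, hence a multiple of it.
    The factor is 1 / |det M|, obtained here only as a positive finite number. *)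
Lemma ge0_integral_lrV_mulmx (R : realType) n (M : 'M[R]_n) : M \in unitmx ->
  exists2 c : R, 0 < c & forall f : borel R n -> \bar R,
    measurable_fun setT f -> (forall x, 0 <= f x)%E ->
    (\int[lrV R n]_z f ((z : 'rV[R]_n) *m M) = c%:E * \int[lrV R n]_z f z)%E.
Proof.
move=> uM.
have mM := @measurable_mulmx R n n M.
have [P PE] := @pushforward_sigma_finite R _ _ _ _ (lrV R n) _
  (fun x : borel R n => (x : 'rV[R]_n) *m invmx M : borel R n)
  (sigma_finiteT _) mM (@measurable_mulmx R n n (invmx M))
  (fun x => mulmxK uM x).
have PA A : P A = lrV R n ((fun x : 'rV[R]_n => x *m M) @^-1` A) by rewrite PE.
have tP : transl_inv P.
  move=> a E mE; rewrite PE /pushforward.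
  have mE' : measurable ((fun x : 'rV[R]_n => x *m M) @^-1` E : set (borel R n)).
    by rewrite -[X in measurable X]setTI; exact: mM.
  apply: eq_trans (@lrV_transl_inv R n (a *m invmx M) _ mE').
  congr (lrV R n _); apply/seteqP.
  by split=> x /=; rewrite mulmxDl mulmxKV.
have PlE E mE := @transl_inv_lrV R n P E tP mE.
set K := P _ in PlE.
have Koo : (K < +oo)%E.
  (* If all coordinates of [x *m M] are at most 1 in absolute value, then coordinate i of [x] is at
     most [C i], so the preimage of the reflected cube lies in a box. *)
  pose C i := \sum_j `|invmx M j i|.
  have C0 i : 0 <= C i by rewrite sumr_ge0.
  apply: (@le_lt_trans _ _ (lrV R n (rectV (fun i => `[- C i, C i]%classic)))).
    rewrite /K PA; apply: le_measure.
    - rewrite inE -[X in measurable X]setTI; apply: mM => //.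
      have mN := @measurable_opprV R n _ _ (fun x : borel R n => x) (@measurable_id _ _ _).
      by rewrite -[X in measurable X]setTI; apply: mN => //; exact: measurable_unit_cube.
    - by rewrite inE; exact: measurable_rectV.
    - move=> x /= h i; rewrite /= in_itv/= -ler_norml.
      rewrite -(mulmxK uM x) mxE.
      apply: (le_trans (ler_norm_sum _ _ _)); apply: ler_sum => j _.
      rewrite normrM ler_piMl// -normrN ger0_norm; have := h j; rewrite mxE => /andP[]//.
  by rewrite lrV_box ?ltry// => i; have := C0 i; lra.
(* A vanishing constant would make the whole space null, although it contains the unit cube. *)
have K0 : (0 < K)%E.
  rewrite lt0e measure_ge0 andbT; apply/eqP => K0.
  have := PlE setT measurableT; rewrite K0 mul0e PA preimage_setT => l0.
  have : (lrV R n (@unit_cube R n) <= lrV R n setT)%E.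
    by apply: le_measure; rewrite ?inE//; exact: measurable_unit_cube.
  by rewrite l0 lrV_unit_cube lee_fin ler10.
have Kfin : K \is a fin_num by rewrite ge0_fin_numE// ltW.
exists (fine K); first by rewrite fine_gt0// K0 Koo.
move=> f mf f0.
have <- : (\int[P]_z f z = (fine K)%:E * \int[lrV R n]_z f z)%E.
  apply: ge0_integral_scaled_measure => //; first by rewrite fine_ge0// ltW.
  by move=> A mA; rewrite fineK//; exact: PlE.
transitivity (\int[pushforward (lrV R n)
    (fun x : borel R n => (x : 'rV[R]_n) *m M : borel R n)]_z f z)%E.
  by rewrite ge0_integral_pushforward.
by rewrite -PE.
Qed.

(** * Hausdorff measure *)

Lemma enorm_ge0 (R : realType) n (x : 'rV[R]_n) : 0 <= enorm x.
Proof. exact: sqrtr_ge0. Qed.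

Lemma dotrv_ge0 (R : realType) n (x : 'rV[R]_n) : 0 <= dotrv x x.
Proof. by apply: sumr_ge0 => i _; rewrite -expr2 sqr_ge0. Qed.

Lemma enorm0 (R : realType) n : enorm (0 : 'rV[R]_n) = 0.
Proof. by rewrite /enorm /dotrv big1 ?sqrtr0// => i _; rewrite mxE mul0r. Qed.

Lemma normr_le_enorm (R : realType) n (x : 'rV[R]_n) i : `|x 0 i| <= enorm x.
Proof.
rewrite -sqrtr_sqr ler_wsqrtr// /dotrv (bigD1 i)//= -expr2 lerDl.
by apply: sumr_ge0 => j _; rewrite -expr2 sqr_ge0.
Qed.

Lemma enorm_le_sum (R : realType) n (x : 'rV[R]_n) :
  enorm x <= \sum_(i < n) `|x 0 i|.
Proof.
have S0 : 0 <= \sum_(i < n) `|x 0 i| by exact: sumr_ge0.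
rewrite -[leRHS]ger0_norm// -sqrtr_sqr ler_wsqrtr// /dotrv expr2 mulr_suml.
apply: ler_sum => i _; rewrite -expr2 -real_normK ?num_real// expr2.
by apply: ler_wpM2l => //; rewrite (bigD1 i)//= lerDl sumr_ge0.
Qed.

Section hausdorff_outer.
Context (R : realType) (k n : nat).
Implicit Types (U V A B : set 'rV[R]_n) (delta : R).
Local Open Scope ereal_scope.

Lemma ediam_ge0 U : U !=set0 -> 0 <= ediam U.
Proof.
move=> [x Ux]; apply: ereal_sup_ubound; exists (x, x) => //=.
by rewrite subrr enorm0.
Qed.

Lemma ediam_set0 : ediam (set0 : set 'rV[R]_n) = -oo.
Proof. by rewrite /ediam setX0 image_set0 ereal_sup0. Qed.

Lemma hausdorff_gauge_ge0 U : 0 <= hausdorff_gauge k U.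
Proof.
rewrite /hausdorff_gauge; case: ifPn => // /set0P U0.
exact/expe_ge0/ediam_ge0.
Qed.

Lemma hausdorff_gauge0 : hausdorff_gauge k (set0 : set 'rV[R]_n) = 0.
Proof. by rewrite /hausdorff_gauge eqxx. Qed.

Local Notation discrete := (g_sigma_algebraType [set: set 'rV[R]_n]).

(** Pricing sets of diameter above [delta] at +oo moves the mesh constraint into the gauge, and the
    discrete sigma-algebra admits every set in a cover. Thus [hausdorff_pre] becomes an instance of
    [mu_ext] and inherits its outer measure properties. *)
Let gauge_delta delta (U : set discrete) : \bar R :=
  if ediam U <= delta%:E then hausdorff_gauge k U else +oo.

Let gauge_delta0 delta : gauge_delta delta set0 = 0.
Proof. by rewrite /gauge_delta ediam_set0 leNye hausdorff_gauge0. Qed.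

Let gauge_delta_ge0 delta U : 0 <= gauge_delta delta U.
Proof. by rewrite /gauge_delta; case: ifP => // _; exact: hausdorff_gauge_ge0. Qed.

Lemma hausdorff_preE delta : hausdorff_pre k delta = mu_ext (gauge_delta delta).
Proof.
apply/funext => A; apply/eqP; rewrite eq_le; apply/andP; split.
  apply: le_ereal_inf_tmp => _ [F [mF AF] <-].
  have [Fd|] := pselect (forall i, ediam (F i) <= delta%:E).
    apply: ereal_inf_lbound; exists F => //.
    by apply: eq_eseriesr => i _; rewrite /gauge_delta Fd.
  move=> /existsNP[i /negP Fi]; rewrite (eseries_pinfty _ (k := i)) ?leey//.
    by move=> j _; rewrite -ltNye (lt_le_trans _ (gauge_delta_ge0 _ _)).
  by rewrite /gauge_delta (negbTE Fi).
apply: le_ereal_inf_tmp => _ [U [Ud AU] <-].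
apply: ereal_inf_lbound; exists U.
  by split=> // i; exact: sub_sigma_algebra.
by apply: eq_eseriesr => i _; rewrite /gauge_delta Ud.
Qed.

Lemma hausdorff_pre_ge0 delta A : 0 <= hausdorff_pre k delta A.
Proof. by rewrite hausdorff_preE; exact: mu_ext_ge0. Qed.

Lemma hausdorff_pre_le delta1 delta2 A : (delta1 <= delta2)%R ->
  hausdorff_pre k delta2 A <= hausdorff_pre k delta1 A.
Proof.
move=> d12; apply: ereal_inf_le_tmp => _ [U [Ud AU] <-]; exists U => //.
by split=> // i; apply: (le_trans (Ud i)); rewrite lee_fin.
Qed.

Lemma hausdorff_pre_le_hausdorff delta A : (0 < delta)%R ->
  hausdorff_pre k delta A <= hausdorff k A.
Proof. by move=> d0; apply: ereal_sup_ubound; exists delta. Qed.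

Let hausdorff_set0 : hausdorff k (set0 : set 'rV[R]_n) = 0.
Proof.
apply/eqP; rewrite eq_le; apply/andP; split.
  apply: ge_ereal_sup => _ [d d0 <-]; rewrite hausdorff_preE mu_ext0//.
apply: (le_trans _ (@hausdorff_pre_le_hausdorff 1%R _ _)) => //.
exact: hausdorff_pre_ge0.
Qed.

Let hausdorff_ge0 A : 0 <= hausdorff k A.
Proof.
apply: (le_trans _ (@hausdorff_pre_le_hausdorff 1%R _ _)) => //.
exact: hausdorff_pre_ge0.
Qed.

Let le_hausdorff : {homo @hausdorff R k n : A B / A `<=` B >-> A <= B}.
Proof.
move=> A B AB; apply: ge_ereal_sup => _ [d d0 <-].
apply: le_trans (hausdorff_pre_le_hausdorff _ d0).
by rewrite hausdorff_preE; exact: le_mu_ext.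
Qed.

Let hausdorff_sigma_subadditive : sigma_subadditive (@hausdorff R k n).
Proof.
move=> F; apply: ge_ereal_sup => _ [d d0 <-].
apply: (@le_trans _ _ (\sum_(i <oo) hausdorff_pre k d (F i))).
  by rewrite hausdorff_preE; exact: mu_ext_sigma_subadditive.
apply: lee_nneseries => i *; first exact: hausdorff_pre_ge0.
exact: hausdorff_pre_le_hausdorff.
Qed.

HB.instance Definition _ := isOuterMeasure.Build R 'rV[R]_n (@hausdorff R k n)
  hausdorff_set0 hausdorff_ge0 le_hausdorff hausdorff_sigma_subadditive.

End hausdorff_outer.

Lemma le_expe (R : realDomainType) (x y : \bar R) k :
  (0 <= x -> x <= y -> x ^+ k <= y ^+ k)%E.
Proof.
move=> x0 xy; elim: k => [|k ih]; first by rewrite !expe0.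
by rewrite !expeS lee_pmul// expe_ge0.
Qed.

Section hausdorff_lipschitz.
Context (R : realType) (k m n : nat).
Local Open Scope ereal_scope.

Lemma ediam_le (U : set 'rV[R]_m) (V : set 'rV[R]_n) :
  (forall x y, V x -> V y -> exists x' y',
    [/\ U x', U y' & (enorm (x - y) <= enorm (x' - y'))%R]) ->
  ediam V <= ediam U.
Proof.
move=> VU; apply: ge_ereal_sup => _ [[x y] [/= Vx Vy] <-].
have [x' [y' [Ux' Uy' le]]] := VU _ _ Vx Vy.
apply: (@le_trans _ _ (enorm (x' - y'))%:E); first by rewrite lee_fin.
by apply: ereal_sup_ubound; exists (x', y').
Qed.

Lemma hausdorff_gauge_le (U : set 'rV[R]_m) (V : set 'rV[R]_n) :
  (forall x y, V x -> V y -> exists x' y',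
    [/\ U x', U y' & (enorm (x - y) <= enorm (x' - y'))%R]) ->
  hausdorff_gauge k V <= hausdorff_gauge k U.
Proof.
move=> VU; rewrite {1}/hausdorff_gauge; case: ifPn => [_|/set0P V0].
  exact: hausdorff_gauge_ge0.
rewrite /hausdorff_gauge ifF.
  by apply: le_expe; [exact: ediam_ge0|exact: ediam_le].
apply/negbTE/set0P; have [x Vx] := V0.
by have [x' [y' []]] := VU _ _ Vx Vx; exists x'.
Qed.

(** Covers are pushed forward by [g]. Each piece is first cut down to [B], the only place where [g]
    is known to contract distances. *)
Lemma hausdorff_lipschitz (g : 'rV[R]_m -> 'rV[R]_n) (B : set 'rV[R]_m) :
  (forall x y, B x -> B y -> (enorm (g x - g y) <= enorm (x - y))%R) ->
  hausdorff k (g @` B) <= hausdorff k B.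
Proof.
move=> gB; apply: ge_ereal_sup => _ [d d0 <-].
apply: le_trans (hausdorff_pre_le_hausdorff _ _ d0).
apply: le_ereal_inf_tmp => _ [U [Ud BU] <-].
have key i x y : (g @` (U i `&` B)) x -> (g @` (U i `&` B)) y -> exists x' y',
    [/\ U i x', U i y' & (enorm (x - y) <= enorm (x' - y'))%R].
  by move=> [x' [Ux' Bx'] <-] [y' [Uy' By'] <-]; exists x', y'; split => //; exact: gB.
apply: (@le_trans _ _ (\sum_(0 <= i <oo) hausdorff_gauge k (g @` (U i `&` B)))).
  apply: ereal_inf_lbound; exists (fun i => g @` (U i `&` B)) => //; split.
    by move=> i; apply: le_trans (Ud i); apply: ediam_le; exact: key.
  move=> _ [x Bx <-]; have [i _ Ux] := BU _ Bx.
  by exists i => //; exists x.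
apply: lee_nneseries => i *; first exact: hausdorff_gauge_ge0.
by apply: hausdorff_gauge_le; exact: key.
Qed.

End hausdorff_lipschitz.

Lemma hausdorff_isometry (R : realType) k m n (g : 'rV[R]_m -> 'rV[R]_n)
    (B : set 'rV[R]_m) :
  (forall x y, B x -> B y -> enorm (g x - g y) = enorm (x - y)) ->
  hausdorff k (g @` B) = hausdorff k B.
Proof.
move=> gB; apply/eqP; rewrite eq_le; apply/andP; split.
  by apply: hausdorff_lipschitz => x y Bx By; rewrite gB.
pose h (y : 'rV[R]_n) : 'rV[R]_m := xget 0 [set x | B x /\ g x = y].
have hP x : B x -> B (h (g x)) /\ g (h (g x)) = g x.
  by move=> Bx; rewrite /h; case: xgetP => [y _ //|/(_ x)]; case.
have hK x : B x -> h (g x) = x.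
  move=> Bx; have [Bh gh] := hP _ Bx.
  have : enorm (h (g x) - x) = 0 by rewrite -gB// gh subrr enorm0.
  move=> e0; apply/eqP; rewrite -subr_eq0; apply/eqP/rowP => i.
  have := normr_le_enorm (h (g x) - x) i.
  by rewrite e0 normr_le0 => /eqP ->; rewrite mxE.
rewrite -[X in (hausdorff k X <= _)%E](_ : h @` (g @` B) = B).
  apply: hausdorff_lipschitz => _ _ [x Bx <-] [y By <-].
  by rewrite !hK// gB.
apply/seteqP; split => [_ [_ [x Bx <-] <-]|x Bx]; first by rewrite hK.
by exists (g x); [exists x|rewrite hK].
Qed.

(** * Caratheodory's criterion for Hausdorff measure *)

Section hausdorff_measure.
Context (R : realType) (k n : nat).
Local Open Scope ereal_scope.
Local Notation H := (@hausdorff R k n).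

(** A set of diameter below [b - a] cannot meet both [A] and [B], so a fine cover splits into the
    pieces meeting [A], which cover [A], and the others, which cover [B]. *)
Lemma hausdorff_separated (A B : set 'rV[R]_n) (i : 'I_n) (a b : R) : (a < b)%R ->
  (forall x, A x -> x 0 i <= a)%R -> (forall x, B x -> b <= x 0 i)%R ->
  H A + H B <= H (A `|` B).
Proof.
move=> ab Aa Bb.
have gap (p q : R) : (b <= p -> q <= a -> p - q < b - a -> False)%R.
  by move=> ? ?; rewrite ltNge => /negP; apply; rewrite lerB.
have pre_add (d : R) : (0 < d < b - a)%R ->
    hausdorff_pre k d A + hausdorff_pre k d B <= H (A `|` B).
  move=> /andP[d0 dab].
  apply: le_trans (hausdorff_pre_le_hausdorff _ _ d0).
  apply: le_ereal_inf_tmp => _ [U [Ud ABU] <-].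
  have [b0 bP] : exists c : nat -> bool, forall j, c j = `[< U j `&` A !=set0 >].
    by exists (fun j => `[< U j `&` A !=set0 >]).
  pose V j := if b0 j then U j else set0.
  pose W j := if b0 j then set0 else U j.
  have -> : \sum_(0 <= j <oo) hausdorff_gauge k (U j) =
     \sum_(0 <= j <oo) hausdorff_gauge k (V j) + \sum_(0 <= j <oo) hausdorff_gauge k (W j).
    rewrite -nneseriesD; try by move=> *; exact: hausdorff_gauge_ge0.
    apply: eq_eseriesr => j _; rewrite /V /W; case: (b0 j).
      by rewrite hausdorff_gauge0 adde0.
    by rewrite hausdorff_gauge0 add0e.
  have sd (j : nat) : ediam (set0 : set 'rV[R]_n) <= d%:E by rewrite ediam_set0 leNye.
  apply: leeD; apply: ereal_inf_lbound.
    exists V => //; split; first by move=> j; rewrite /V; case: (b0 j); [exact: Ud|exact: sd].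
    move=> x Ax; have [j _ Ux] := ABU x (or_introl Ax); exists j => //.
    by rewrite /V bP; case: asboolP => // -[]; exists x.
  exists W => //; split; first by move=> j; rewrite /W; case: (b0 j); [exact: sd|exact: Ud].
  move=> x Bx; have [j _ Ux] := ABU x (or_intror Bx); exists j => //.
  rewrite /W bP; case: asboolP => // -[y [Uy Ay]].
  have : ((enorm (x - y))%:E <= d%:E).
    by apply: le_trans (Ud j); apply: ereal_sup_ubound; exists (x, y).
  rewrite lee_fin => xyd.
  have := le_lt_trans (le_trans (normr_le_enorm (x - y) i) xyd) dab; rewrite !mxE.
  by move=> /(le_lt_trans (ler_norm _))/(gap _ _ (Bb _ Bx) (Aa _ Ay)).
(* Independent meshes for [A] and [B], obtained from a common finer one, allow the two suprema to be
   taken one after the other. *)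
have pre_add2 (d1 d2 : R) : (0 < d1)%R -> (0 < d2)%R ->
    hausdorff_pre k d1 A + hausdorff_pre k d2 B <= H (A `|` B).
  move=> d10 d20; pose d : R := Num.min (Num.min d1 d2) ((b - a) / 2)%R.
  have ba2 : (0 < (b - a) / 2)%R by rewrite divr_gt0// subr_gt0.
  apply: le_trans (@pre_add d _); last first.
    rewrite /d !lt_min d10 d20 ba2/= gt_min; apply/orP; right.
    by rewrite gtr_pMr ?subr_gt0// invf_lt1// ltr1n.
  by apply: leeD; apply: hausdorff_pre_le; rewrite /d !ge_min lexx ?orbT.
have [->|Hoo] := eqVneq (H (A `|` B)) +oo; first by rewrite leey.
have Hfin : H (A `|` B) \is a fin_num.
  by rewrite ge0_fin_numE ?outer_measure_ge0// ltey.
have AB0 (d1 d2 : R) : (0 < d1)%R -> (0 < d2)%R ->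
    hausdorff_pre k d1 A <= H (A `|` B) - hausdorff_pre k d2 B.
  move=> d10 d20; rewrite leeBrDr ?pre_add2// ge0_fin_numE ?hausdorff_pre_ge0//.
  apply: le_lt_trans (_ : H (A `|` B) < +oo); last by rewrite ltey.
  by apply: le_trans (pre_add2 1%R d2 _ _) => //; rewrite leeDr// hausdorff_pre_ge0.
have HAfin : H A \is a fin_num.
  rewrite ge0_fin_numE ?outer_measure_ge0//.
  apply: le_lt_trans (_ : H (A `|` B) < +oo); last by rewrite ltey.
  exact: le_outer_measure.
rewrite addeC -leeBrDr//; apply: ge_ereal_sup => _ [d2 d20 <-].
have HBd : hausdorff_pre k d2 B \is a fin_num.
  rewrite ge0_fin_numE ?hausdorff_pre_ge0//.
  apply: le_lt_trans (_ : H (A `|` B) < +oo); last by rewrite ltey.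
  by apply: le_trans (pre_add2 1%R d2 _ _) => //; rewrite leeDr// hausdorff_pre_ge0.
rewrite leeBrDl// addeC -leeBrDl// ; apply: ge_ereal_sup => _ [d1 d10 <-].
exact: AB0.
Qed.

End hausdorff_measure.

Section hausdorff_borel.
Context (R : realType) (k n : nat).
Local Open Scope ereal_scope.
Local Notation H := (@hausdorff R k n).

Let hc (m : nat) : R := m.+1%:R^-1.

Let hc_lt m p : (m < p)%N -> (hc p < hc m)%R.
Proof. by move=> mp; rewrite /hc ltf_pV2 ?posrE// ltr_nat. Qed.

Let hc_le m p : (m <= p)%N -> (hc p <= hc m)%R.
Proof. by move=> mp; rewrite /hc lef_pV2 ?posrE// ler_nat. Qed.

Let strip (X : set 'rV[R]_n) i (a : R) m :=
  X `&` [set x | (hc m.+1 <= x 0 i - a < hc m)%R].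

(* Strips of the same parity are pairwise separated. *)
Let strip_sum X i a p N :
  \sum_(m < N) H (strip X i a (m.*2 + p)) <= H X.
Proof.
suff h : \sum_(m < N) H (strip X i a (m.*2 + p)) <=
    H (\big[setU/set0]_(m < N) strip X i a (m.*2 + p)).
  apply: (le_trans h); apply: le_outer_measure.
  by rewrite -(bigcup_mkord N (fun m => strip X i a (m.*2 + p))) => x [m _ []].
elim: N => [|N ih]; first by rewrite !big_ord0 outer_measure0.
rewrite !big_ord_recr/=; apply: (le_trans (leeD2r _ ih)).
rewrite [X in _ <= H X]setUC addeC.
case: N ih => [_|N _].
  by rewrite big_ord0 setU0 outer_measure0 adde0.
apply: (@hausdorff_separated _ _ _ _ _ i (a + hc (N.+1.*2 + p))%R (a + hc (N.*2 + p).+1)%R).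
- by rewrite ltrD2l; apply: hc_lt; rewrite doubleS addSn.
- by move=> x [_ /andP[_ /ltW]]; rewrite lerBlDl.
- rewrite -(bigcup_mkord N.+1 (fun m => strip X i a (m.*2 + p))) => x [m /= mN [_ /andP[h _]]].
  rewrite -lerBrDl; apply: le_trans h; apply: hc_le.
  by rewrite ltnS leq_add2r leq_double -ltnS.
Qed.

(** Consecutive strips touch, so even and odd indices are bounded separately, each by [H X]; hence
    the two copies of [H X]. *)
Let strip_series X i a : \sum_(m <oo) H (strip X i a m) <= H X + H X.
Proof.
apply: lime_le.
  by apply: is_cvg_nneseries => *; exact: outer_measure_ge0.
apply: nearW => N.
apply: (@le_trans _ _ (\sum_(0 <= m < N.*2) H (strip X i a m))).
  rewrite (@big_cat_nat _ _ _ N 0 N.*2)//=; last by rewrite -addnn leq_addl.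
  by rewrite leeDl// sume_ge0// => *; exact: outer_measure_ge0.
have -> : \sum_(0 <= m < N.*2) H (strip X i a m) =
    \sum_(m < N) H (strip X i a (m.*2 + 0)) + \sum_(m < N) H (strip X i a (m.*2 + 1)).
  elim: N => [|N ih]; first by rewrite big_nil !big_ord0 adde0.
  rewrite doubleS !big_nat_recr//= ih !big_ord_recr/= addn0 addn1.
  by rewrite -addeA addeACA.
by apply: leeD; exact: strip_sum.
Qed.

(** Additivity is clear after removing from [X] the slab of width [hc N] beyond the hyperplane. The
    removed part is covered by the strips of index at least N, and the tail of their convergent
    series tends to 0. *)
Lemma hausdorff_caratheodory_halfspace (i : 'I_n) (a : R) :
  H.-caratheodory [set x : 'rV[R]_n | (x 0 i <= a)%R].
Proof.
apply: le_caratheodory_measurable => X; set S := [set x | _].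
change (H (X `&` S) + H (X `&` ~` S) <= H X).
have [->|Xoo] := eqVneq (H X) +oo; first by rewrite leey.
have XfinH : H X \is a fin_num by rewrite ge0_fin_numE ?outer_measure_ge0// ltey.
have soo : \sum_(m <oo) H (strip X i a m) < +oo.
  apply: le_lt_trans (strip_series _ _ _) _.
  by rewrite -ge0_fin_numE ?fin_numD ?XfinH// adde_ge0 ?outer_measure_ge0.
have tail := nneseries_tail_cvg soo (fun m _ => outer_measure_ge0 _ _).
suff key N : H (X `&` S) + H (X `&` ~` S) <= H X + \sum_(N <= m <oo) H (strip X i a m).
  have : (fun N => H X + \sum_(N <= m <oo) H (strip X i a m)) @ \oo --> H X + 0.
    by apply: cvgeD => //; [exact: fin_num_adde_defl|exact: cvg_cst].
  rewrite adde0 => /cvg_lim <-//; apply: lime_ge.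
    apply/cvg_ex; exists (H X + 0); apply: cvgeD => //.
      exact: fin_num_adde_defl.
    exact: cvg_cst.
  exact: nearW.
pose A := X `&` [set x | (a + hc N <= x 0 i)%R].
have c0 m : (0 < hc m)%R by rewrite /hc invr_gt0.
apply: (@le_trans _ _ (H (X `&` S) + (H A + \sum_(N <= m <oo) H (strip X i a m)))).
  apply: leeD2l.
  apply: (@le_trans _ _ (H (A `|` \bigcup_(m in ~` `I_N) strip X i a m))).
    apply: le_outer_measure => x [Xx /negP]; rewrite -ltNge => ax.
    have [Nx|xN] := leP (a + hc N)%R (x 0 i)%R; first by left.
    right.
    have /ltr_add_invr[q] : (a < x 0 i)%R by [].
    rewrite -ltrBrDl => hq.
    (* Let p be the least index with [hc p <= x 0 i - a]. It exceeds N because the point lies in the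
       slab, and by minimality the point lies in the strip of index p - 1, which is at least N. *)
    have exq : exists q, (hc q <= x 0 i - a)%R by exists q; exact: ltW.
    have q0 := ex_minnP exq; case: q0 => p hp pmin.
    have Np : (N < p)%N.
      rewrite ltnNge; apply/negP => pN.
      have := le_trans (hc_le pN) hp.
      by rewrite lerBrDl leNgt xN.
    case: p hp pmin Np => // p hp pmin Np.
    exists p; first by move=> /=; apply/negP; rewrite -leqNgt -ltnS.
    split=> //=; rewrite hp/= ltNge; apply/negP => /pmin.
    by rewrite ltnn.
  apply: le_trans (outer_measureU2 _ _ _) _; apply: leeD2l.
  exact: outer_measure_sigma_subadditive_tail.
rewrite addeA; apply: leeD2r.
apply: (@le_trans _ _ (H ((X `&` S) `|` A))).
  apply: (@hausdorff_separated _ _ _ _ _ i a (a + hc N)%R).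
  - by rewrite ltrDl.
  - by move=> x [].
  - by move=> x [].
by apply: le_outer_measure => x [[]|[]].
Qed.

(** The Caratheodory sets form a sigma-algebra; read as a map out of it, the identity is measurable
    once its coordinates are, and that is a statement about half-spaces. *)
Lemma borel_caratheodory (A : set (borel R n)) : measurable A ->
  H.-caratheodory A.
Proof.
move=> mA.
have : measurable_fun setT (fun x : caratheodory_type H => x : borel R n).
  apply: measurable_rowP => i.
  apply: (measurability _ (RGenOInfty.measurableE R)) => _ [_ [a ->] <-].
  rewrite setTI (_ : _ @^-1` _ = ~` [set x : 'rV[R]_n | (x 0 i <= a)%R]); last first.
    by apply/seteqP; split => x /=; rewrite in_itv/= andbT ltNge => /negP.
  exact/caratheodory_measurable_setC/hausdorff_caratheodory_halfspace.
by move=> /(_ measurableT A mA); rewrite setTI.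
Qed.

Let hausdorff_sigma_additive :
  semi_sigma_additive (H : set (borel R n) -> \bar R).
Proof.
move=> F mF tF mUF; apply: (@caratheodory_measure_sigma_additive R _ H F) => //.
- by move=> i; exact: borel_caratheodory.
- exact: borel_caratheodory.
Qed.

Definition hausdorff_borel : set (borel R n) -> \bar R := H.

HB.instance Definition _ := isMeasure.Build _ (borel R n) R hausdorff_borel
  (outer_measure0 H) (outer_measure_ge0 H) hausdorff_sigma_additive.

End hausdorff_borel.

(** * Comparison of Hausdorff and Lebesgue measure in full dimension *)

Lemma grid_index (R : realType) (s t : R) N :
  0 <= t <= s * N.+1%:R -> exists j : 'I_N.+1, s * j%:R <= t <= s * j.+1%:R.
Proof.
elim: N => [|N ih] /andP[t0 tN].
  by exists ord0; rewrite mulr0 t0.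
have [tN1|/ltW Nt] := leP t (s * N.+1%:R).
  have [|j /andP[j1 j2]] := ih; first by rewrite t0.
  by exists (widen_ord (leqnSn _) j); rewrite j1.
by exists ord_max; rewrite Nt.
Qed.

(** A grid of [(N + 1) ^ n] cells of side [s = 2 * L / (N + 1)], each of diameter at most [n * s],
    costs at most [(2 * L * n) ^ n], a bound free of N and hence of the mesh. *)
Lemma hausdorff_cube_fin (R : realType) n (L : R) : 0 < L ->
  (hausdorff n (rectV (fun=> `[(- L)%R, L]%classic) : set 'rV[R]_n) < +oo)%E.
Proof.
move=> L0.
suff h : (hausdorff n (rectV (fun=> `[(- L)%R, L]%classic) : set 'rV[R]_n) <=
    ((2 * L * n%:R) ^+ n)%:E)%E by apply: le_lt_trans h _; rewrite ltry.
apply: ge_ereal_sup => _ [d d0 <-].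
(* This choice of N is what makes the cell diameter bound [n * s] at most the mesh [d]. *)
have [N hN] : exists N, 2 * L * n%:R / d <= N.+1%:R.
  exists (Num.truncn (2 * L * n%:R / d)); apply: ltW; exact: truncnS_gt.
pose s : R := 2 * L / N.+1%:R.
have N0 : N.+1%:R != 0 :> R by rewrite pnatr_eq0.
have s0 : 0 < s by rewrite divr_gt0// mulr_gt0.
have nsd : n%:R * s <= d.
  rewrite /s mulrA [n%:R * _]mulrC ler_pdivrMr//.
  by rewrite [d * _]mulrC -ler_pdivrMr.
pose I : finType := {ffun 'I_n -> 'I_N.+1}.
pose cube (j : I) : set 'rV[R]_n :=
  [set x | forall i, s * (j i)%:R <= x 0 i + L <= s * (j i).+1%:R].
(* The finite grid is padded to a sequence by empty sets, which have gauge 0. *)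
pose U (q : nat) : set 'rV[R]_n :=
  if insub q is Some o then cube (@enum_val I predT o) else set0.
have cube_diam j : (ediam (cube j) <= (n%:R * s)%:E)%E.
  apply: ge_ereal_sup => _ [[x y] [/= cx cy] <-]; rewrite lee_fin.
  apply: le_trans (enorm_le_sum _) _.
  rewrite -[n in leRHS]card_ord -sum1_card natr_sum mulr_suml.
  apply: ler_sum => i _; rewrite mul1r !mxE.
  have := cx i; have := cy i; rewrite -natr1 mulrDr mulr1.
  by rewrite ler_norml => /andP[? ?] /andP[? ?]; apply/andP; split; lra.
have gauge_cube j : (hausdorff_gauge n (cube j) <= ((n%:R * s) ^+ n)%:E)%E.
  rewrite /hausdorff_gauge; case: ifPn => [_|/set0P c0].
    by rewrite lee_fin exprn_ge0// mulr_ge0// ltW.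
  by rewrite EFin_expe; apply: le_expe => //; exact: ediam_ge0.
have MM : (#|I| = N.+1 ^ n)%N by rewrite card_ffun !card_ord.
apply: (@le_trans _ _ (\sum_(0 <= q <oo) hausdorff_gauge n (U q))%E).
  apply: ereal_inf_lbound; exists U => //; split.
    move=> q; rewrite /U; case: insubP => [w _ _|_].
      by apply: (le_trans (cube_diam _)); rewrite lee_fin.
    by rewrite ediam_set0 leNye.
  move=> x xL.
  have /choice[j jP] : forall i : 'I_n, exists j : 'I_N.+1,
      s * j%:R <= x 0 i + L <= s * j.+1%:R.
    move=> i; apply: grid_index; have := xL i; rewrite /= in_itv/=.
    by rewrite /s divfK// => /andP[? ?]; apply/andP; split; lra.
  pose q : 'I_#|I| := enum_rank ([ffun i => j i] : I).
  exists (val q) => //; rewrite /U insubT//= => qI.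
  rewrite (_ : Sub _ _ = q); last exact: val_inj.
  by rewrite enum_rankK => i; rewrite ffunE.
rewrite (nneseries_split 0 #|I|); last by move=> *; exact: hausdorff_gauge_ge0.
rewrite add0n [X in (_ + X)%E]eseries0 ?adde0; last first.
  move=> q Iq _; rewrite /U insubF ?hausdorff_gauge0//.
  by apply/negbTE; rewrite -leqNgt.
apply: (@le_trans _ _ (\sum_(0 <= q < #|I|) ((n%:R * s) ^+ n)%:E)%E).
  apply: lee_sum => q _; rewrite /U; case: insubP => [w _ _|_].
    exact: gauge_cube.
  by rewrite hausdorff_gauge0 lee_fin exprn_ge0// mulr_ge0// ltW.
rewrite sumEFin lee_fin big_const_nat iter_addr addr0 subn0 MM.
rewrite -[_ *+ (_ ^ _)%N]mulr_natr natrX -exprMn /s.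
by rewrite [X in X ^+ n <= _](_ : _ = 2 * L * n%:R)//; field.
Qed.

(** A set of diameter D lies in a box of side 2D, whose Lebesgue measure is 2^n times the gauge of
    the set. Covers of the unit cube therefore cost at least 2^-n. The boxes also replace pieces
    that may fail to be measurable. *)
Lemma hausdorff_cube_gt0 (R : realType) n :
  (0 < hausdorff n (@unit_cube R n))%E.
Proof.
have n2 : 0 < (2 ^+ n)^-1 :> R by rewrite invr_gt0 exprn_gt0.
apply: (@lt_le_trans _ _ ((2 ^+ n)^-1)%:E); first by rewrite lte_fin.
(* Mesh 1 is enough for a lower bound and forces the diameters of all nonempty pieces to be
   finite. *)
apply: le_trans (@hausdorff_pre_le_hausdorff R n n 1 _ ltr01).
apply: le_ereal_inf_tmp => _ [U [Ud QU] <-].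
have fdiam i : U i !=set0 -> exists2 D : R, 0 <= D & ediam (U i) = D%:E.
  move=> U0; have := ediam_ge0 U0; have := Ud i.
  by case: (ediam _) => // r _; rewrite lee_fin => r0; exists r.
have /choice[C CP] : forall i, exists C : set (borel R n),
    [/\ measurable C, U i `<=` C & (lrV R n C <= (2 ^+ n)%:E * hausdorff_gauge n (U i))%E].
  move=> i; have [->|/set0P U0] := eqVneq (U i) set0.
    by exists set0; split => //; rewrite measure0 hausdorff_gauge0 mule0.
  have [D D0 DE] := fdiam _ U0; have [x Ux] := U0.
  exists (rectV (fun j => `[x 0 j - D, x 0 j + D]%classic)); split.
  - exact: measurable_rectV.
  - move=> y Uy j; rewrite /= in_itv/= -ler_distl.
    have xy : enorm (y - x) <= D.
      by rewrite -lee_fin -DE; apply: ereal_sup_ubound; exists (y, x).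
    by apply: le_trans xy; have := normr_le_enorm (y - x) j; rewrite !mxE.
  - rewrite lrV_box; last by move=> j; lra.
    rewrite /hausdorff_gauge ifF; last exact/negbTE/set0P.
    rewrite DE -EFin_expe -EFinM lee_fin -exprMn.
    rewrite (eq_bigr (fun=> 2 * D)) ?prodr_const ?card_ord// => j _; ring.
have : (lrV R n (@unit_cube R n) <= \sum_(0 <= i <oo) lrV R n (C i))%E.
  apply: measure_sigma_subadditive => //.
  - by move=> i; have [] := CP i.
  - exact: measurable_unit_cube.
  - by move=> x /QU[i _ Ux]; exists i => //; have [_ + _] := CP i; exact.
rewrite lrV_unit_cube => /le_trans h.
rewrite -(@lee_pmul2l _ (2 ^+ n)%:E) ?lte_fin ?exprn_gt0//.
rewrite -EFinM mulfV ?expf_neq0// -nneseriesZl; last by move=> *; exact: hausdorff_gauge_ge0.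
by apply: h; apply: lee_nneseries => i *; [exact: measure_ge0|have [] := CP i].
Qed.

Lemma hausdorff_lebesgue (R : realType) n : exists2 c : R, 0 < c &
  forall E : set (borel R n), measurable E ->
    (hausdorff n (E : set 'rV[R]_n) = c%:E * lrV R n E)%E.
Proof.
pose H := @hausdorff_borel R n n.
have sH : sigma_finite setT H.
  exists (fun m => rectV (fun=> `[- m.+1%:R, m.+1%:R]%classic)).
    apply/seteqP; split => // x _.
    exists (Num.truncn (\sum_i `|(x : 'rV[R]_n) 0 i|)) => // i.
    rewrite /= in_itv/= -ler_norml; apply: ltW; apply: le_lt_trans (truncnS_gt _).
    by rewrite (bigD1 i)//= lerDl sumr_ge0.
  by move=> m; split; [exact: measurable_rectV|exact: hausdorff_cube_fin].
pose P : {sigma_finite_measure set _ -> \bar R} :=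
  HB.pack H (Measure_isSigmaFinite.Build _ _ _ H sH).
have tP : transl_inv P.
  move=> a E mE; rewrite /P /= /H /hausdorff_borel.
  rewrite (_ : _ @^-1` E = (fun x : 'rV[R]_n => x - a) @` E).
    by apply: hausdorff_isometry => x y _ _; rewrite opprD opprK addrACA addNr addr0.
  apply/seteqP; split => [x Ex|_ [x Ex <-]]; last by rewrite /= subrK.
  by exists (x + a) => //; rewrite addrK.
have key E mE := @transl_inv_lrV R n P E tP mE.
set K := P _ in key.
have Koo : (K < +oo)%E.
  apply: le_lt_trans (@hausdorff_cube_fin R n 1 ltr01).
  apply: (le_outer_measure (@hausdorff R n n)) => x h i.
  by have := h i; rewrite /= in_itv/= mxE => /andP[? ?]; apply/andP; split; lra.
have K0 : (0 < K)%E.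
  (* Evaluated on the unit cube, the proportionality says that [K] is the Hausdorff measure of that
     cube. *)
  have := key _ (@measurable_unit_cube R n); rewrite lrV_unit_cube mule1 => <-.
  exact: hausdorff_cube_gt0.
exists (fine K); first by rewrite fine_gt0// K0 Koo.
by move=> E mE; rewrite fineK ?ge0_fin_numE ?(ltW K0)//; exact: key.
Qed.

(** * Affine copies of the unit cube *)

Lemma dotrvE (R : realType) n (x y : 'rV[R]_n) : dotrv x y = (x *m y^T) 0 0.
Proof. by rewrite mxE; apply: eq_bigr => i _; rewrite mxE. Qed.

Lemma dotrvC (R : realType) n (x y : 'rV[R]_n) : dotrv x y = dotrv y x.
Proof. by apply: eq_bigr => i _; rewrite mulrC. Qed.

Lemma dotrvDl (R : realType) n (x y z : 'rV[R]_n) :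
  dotrv (x + y) z = dotrv x z + dotrv y z.
Proof. by rewrite !dotrvE mulmxDl mxE. Qed.

Lemma dotrvDr (R : realType) n (x y z : 'rV[R]_n) :
  dotrv x (y + z) = dotrv x y + dotrv x z.
Proof. by rewrite dotrvC dotrvDl !(dotrvC x). Qed.

Lemma dotrvNr (R : realType) n (x y : 'rV[R]_n) : dotrv x (- y) = - dotrv x y.
Proof. by rewrite !dotrvE raddfN mulmxN mxE. Qed.

Lemma dotrv_mulmx (R : realType) m n (z : 'rV[R]_n) (y : 'rV[R]_m) (A : 'M[R]_(m, n)) :
  dotrv z (y *m A) = dotrv (z *m A^T) y.
Proof. by rewrite !dotrvE trmx_mul mulmxA. Qed.

Lemma dotrv_sub (R : realType) n (x y : 'rV[R]_n) :
  dotrv (x - y) (x - y) = dotrv x x - 2 * dotrv x y + dotrv y y.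
Proof.
rewrite dotrvDl !dotrvDr !dotrvNr (dotrvC (- y)) (dotrvC (- y)) !dotrvNr.
ring.
Qed.

Lemma dotrv_enorm (R : realType) n (x : 'rV[R]_n) : dotrv x x = enorm x ^+ 2.
Proof. by rewrite /enorm sqr_sqrtr// dotrv_ge0. Qed.

Lemma dotrv_eq0 (R : realType) n (x : 'rV[R]_n) : dotrv x x = 0 -> x = 0.
Proof.
move=> x0; apply/rowP => i; rewrite mxE; apply/eqP.
by rewrite -normr_le0 (le_trans (normr_le_enorm x i))// /enorm x0 sqrtr0.
Qed.

Lemma enorm_mulmx_isometry (R : realType) k n (A : 'M[R]_(k, n)) (x : 'rV[R]_k) :
  A *m A^T = 1%:M -> enorm (x *m A) = enorm x.
Proof. by move=> AA; rewrite /enorm dotrv_mulmx -mulmxA AA mulmx1. Qed.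

(* Polarization: [f - f 0] preserves inner products, so its coordinates in the
   orthonormal family [f e_i - f 0] are those of its argument. *)
Lemma isometric_affine (R : realType) k n (f : 'rV[R]_k -> 'rV[R]_n) :
  isometric_on (@unit_cube R k) f ->
  exists b (A : 'M[R]_(k, n)), A *m A^T = 1%:M /\
    forall x, @unit_cube R k x -> f x = b + x *m A.
Proof.
move=> fi; pose h x := f x - f 0.
have Q0 : @unit_cube R k 0 by move=> i; rewrite mxE lexx ler01.
have hd x : @unit_cube R k x -> dotrv (h x) (h x) = dotrv x x.
  by move=> Qx; rewrite !dotrv_enorm /h fi// subr0.
have hxy x y : @unit_cube R k x -> @unit_cube R k y -> dotrv (h x) (h y) = dotrv x y.
  move=> Qx Qy.
  have : dotrv (h x - h y) (h x - h y) = dotrv (x - y) (x - y).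
    by rewrite !dotrv_enorm /h opprB addrA subrK fi.
  rewrite (dotrv_sub (h x)) (dotrv_sub x) !hd// => /addIr/addrI/oppr_inj.
  by move/mulfI; apply; rewrite pnatr_eq0.
have Qe i : @unit_cube R k (delta_mx 0 i).
  by move=> j; rewrite mxE eqxx/=; case: (_ == _); rewrite /= ?lexx ?ler01.
pose A := \matrix_(i < k) h (delta_mx 0 i).
have hA x : @unit_cube R k x -> h x *m A^T = x.
  move=> Qx; apply/rowP => i.
  transitivity (dotrv (h x) (h (delta_mx 0 i))).
    by rewrite mxE; apply: eq_bigr => j _; rewrite !mxE.
  rewrite hxy// /dotrv (bigD1 i)//= big1 => [|j ji].
    by rewrite mxE !eqxx mulr1 addr0.
  by rewrite mxE (negbTE ji) andbF mulr0.
have AA : A *m A^T = 1%:M.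
  by apply/row_matrixP => i; rewrite row_mul rowK hA// rowE mulmx1.
exists (f 0), A; split => // x Qx.
(* The residual has squared norm |x|^2 - 2 |x|^2 + |x|^2 = 0. *)
suff : h x - x *m A = 0 by move=> /subr0_eq <-; rewrite addrC subrK.
apply: dotrv_eq0; rewrite (dotrv_sub (h x)) hd// dotrv_mulmx hA//.
by rewrite dotrv_mulmx -mulmxA AA mulmx1; ring.
Qed.

Lemma continuous_sum (R : realType) (T : topologicalType) (I : Type) (s : seq I)
    (F : I -> T -> R) :
  (forall i, continuous (F i)) -> continuous (fun y => \sum_(i <- s) F i y).
Proof.
move=> cF; elim: s => [|i s ih] y.
  under eq_fun do rewrite big_nil.
  exact: cvg_cst.
under eq_fun do rewrite big_cons.
by apply: cvgD; [exact: cF|exact: ih].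
Qed.

Lemma continuous_mulmx_coord (R : realType) m n (B : 'M[R]_(m, n)) (b : 'rV[R]_m) j :
  continuous (fun y : 'rV[R]_m => ((y - b) *m B) 0 j).
Proof.
rewrite (_ : (fun _ => _) = fun y : 'rV[R]_m => \sum_i (y 0 i - b 0 i) * B i j).
  apply: continuous_sum => i y.
  apply: (@continuousM _ _ (fun z : 'rV[R]_m => z 0 i - b 0 i) (fun=> B i j)).
    apply: (@continuousB _ _ _ (fun z : 'rV[R]_m => z 0 i) (fun=> b 0 i)).
      exact: coord_continuous.
    exact: cst_continuous.
  exact: cst_continuous.
by apply/funext => y; rewrite mxE; apply: eq_bigr => i _; rewrite !mxE.
Qed.

(** The matrix [A^T *m A] is the orthogonal projection onto the row space of [A]. So y lies in the
    image exactly when this projection fixes [y - b] and the coordinates [(y - b) *m A^T] lie in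
    [0, 1]: finitely many closed conditions. *)
Lemma closed_affine_cube (R : realType) k n (A : 'M[R]_(k, n)) (b : 'rV[R]_n) :
  A *m A^T = 1%:M ->
  closed [set b + x *m A | x in @unit_cube R k].
Proof.
move=> AA.
rewrite (_ : [set _ | _ in _] =
  (\bigcap_(i in [set: 'I_k]) (fun y => ((y - b) *m A^T) 0 i) @^-1` `[0, 1]%classic) `&`
  (\bigcap_(j in [set: 'I_n]) (fun y => ((y - b) *m (A^T *m A - 1%:M)) 0 j) @^-1` `[0, 0]%classic)).
  apply: closedI; apply: closed_bigI => i _; apply: preimage_closed => //.
  - by move=> y _; exact: continuous_mulmx_coord.
  - exact: itv_closed.
  - by move=> y _; exact: continuous_mulmx_coord.
  - exact: itv_closed.
apply/seteqP; split => [_ [x Qx <-]|y [yQ yA]].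
  rewrite [b + _]addrC; split => i _ /=; rewrite addrK.
    by rewrite -mulmxA AA mulmx1 in_itv; exact: Qx.
  by rewrite mulmxBr mulmx1 -!mulmxA (mulmxA A) AA mul1mx subrr mxE in_itv/= lexx.
exists ((y - b) *m A^T).
  by move=> i; have := yQ i Logic.I; rewrite /= in_itv.
suff : (y - b) *m (A^T *m A - 1%:M) = 0.
  rewrite mulmxBr mulmx1 mulmxA => /subr0_eq ->; by rewrite addrC subrK.
apply/rowP => j; rewrite [RHS]mxE; have := yA j Logic.I.
by rewrite /= in_itv/= -eq_le => /eqP.
Qed.

Lemma measurable_dotrv (R : realType) n (z : 'rV[R]_n) :
  measurable_fun setT (fun x : borel R n => dotrv z x).
Proof.
apply: measurable_sum => i; apply: measurable_funM => //.
exact: measurable_coord.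
Qed.

Lemma measurable_cos_dotrv (R : realType) n (z : 'rV[R]_n) (psi : R) :
  measurable_fun setT (fun x : borel R n => cos (psi + dotrv z x)).
Proof.
apply: measurableT_comp; first by apply: continuous_measurable_fun; exact: continuous_cos.
by apply: measurable_funD => //; exact: measurable_dotrv.
Qed.

Lemma cos_addr1_ge0 (R : realType) (t : R) : 0 <= 1 + cos t.
Proof. by have := cos_geN1 t; lra. Qed.

Lemma integral_cos_unit_cube (R : realType) n (u : 'rV[R]_n) (phi : R) :
  (\int[lrV R n]_(x in @unit_cube R n) (1 + cos (phi + dotrv u x))%:E =
   (1 + (\prod_(i < n) sinc (u 0 i)) * cos (phi + \sum_(i < n) u 0 i / 2))%:E)%E.
Proof.
have mcos : measurable_fun setT (fun x : borel R n => (1 + cos (phi + dotrv u x))%:E).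
  by apply/measurable_EFinP; apply: measurable_funD => //; exact: measurable_cos_dotrv.
rewrite integral_mkcond ge0_integral_lrV.
- rewrite -integral_cos_ltuple; apply: eq_integral => t _.
  rewrite /patch unit_cubeE; set x := \row_i _.
  have Ix := @indic_rectV R n (fun=> `[0%R, 1%R]%classic) x.
  have -> : \prod_(i < n) \1_(`[0%R, 1%R]%classic) (tnth t i) =
      (x \in rectV (fun=> `[0%R, 1%R]%classic))%:R :> R.
    by rewrite -indicE Ix; apply: eq_bigr => i _; rewrite mxE.
  case: ifP => _; last by rewrite mul0r.
  by rewrite mul1r; congr (1 + cos (_ + _))%:E; apply: eq_bigr => i _; rewrite mxE.
- apply/(measurable_restrictT _ _).1; first exact: measurable_unit_cube.
  exact: measurable_funTS.
- by move=> x; rewrite /patch; case: ifP => // _; rewrite lee_fin cos_addr1_ge0.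
Qed.

Lemma ge0_integral_mrestr (R : realType) d (T : measurableType d)
    (m : {measure set T -> \bar R}) (D : set T) (mD : measurable D) (f : T -> \bar R) :
  measurable_fun setT f -> (forall x, 0 <= f x)%E ->
  (\int[mrestr m mD]_x f x = \int[m]_(x in D) f x)%E.
Proof.
move=> mf f0.
have mN : mrestr m mD (~` D) = 0%E by rewrite /mrestr setICl measure0.
rewrite (ge0_negligible_integral (measurableC mD) _ _ _ mN)//.
rewrite setTD setCK; apply: eq_measure_integral => A mA AD.
by change (m (A `&` D) = m A); rewrite (setIidl AD).
Qed.

(** [P] is c times the image of Lebesgue measure on the cube under an affine map. Stated through
    integrals, it frees the Fourier computations from any mention of Hausdorff measure. *)
Definition is_affine_cube_measure (R : realType) k n (A : 'M[R]_(k, n))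
    (b : 'rV[R]_n) (c : R) (P : set (borel R n) -> \bar R) : Prop :=
  forall f : borel R n -> \bar R, measurable_fun setT f -> (forall x, 0 <= f x)%E ->
  (\int[P]_x f x =
   c%:E * \int[lrV R k]_(x in @unit_cube R k) f (b + (x : 'rV[R]_k) *m A)%R)%E.

Lemma affine_cube_measure_setT (R : realType) k n (A : 'M[R]_(k, n)) (b : 'rV[R]_n)
    (c : R) (P : {measure set (borel R n) -> \bar R}) :
  is_affine_cube_measure A b c P -> P setT = c%:E.
Proof.
move=> hP; have -> : P setT = (\int[P]_x (1%:E : \bar R))%E.
  by rewrite integral_cst// mul1e.
rewrite (hP (fun=> 1%:E)) ?lee_fin//.
have -> : (\int[lrV R k]_(x in @unit_cube R k) 1%:E = 1%:E)%E.
  rewrite integral_cst; last exact: measurable_unit_cube.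
  by rewrite mul1e; exact: lrV_unit_cube.
by rewrite mule1.
Qed.

Lemma hausdorff_restr_measure (R : realType) k n (A : 'M[R]_(k, n)) (b : 'rV[R]_n) :
  A *m A^T = 1%:M -> exists2 c : R, 0 < c &
  exists2 P : {finite_measure set (borel R n) -> \bar R},
    (P : set _ -> \bar R) = hausdorff_restr k [set b + x *m A | x in @unit_cube R k] &
    is_affine_cube_measure A b c P.
Proof.
move=> AA; have [c c0 cP] := hausdorff_lebesgue R k.
exists c => //.
pose g (x : borel R k) : borel R n := b + (x : 'rV[R]_k) *m A.
have mg : measurable_fun setT g.
  by apply: measurable_addrV; [exact: measurable_cst|exact: measurable_mulmx].
pose ph : {mfun _ >-> _} := HB.pack g (isMeasurableFun.Build _ _ _ _ _ mg).
have mQ := @measurable_unit_cube R k.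
pose M := pushforward (mrestr (@hausdorff_borel R k k) mQ) ph.
have ME B : measurable B -> M B = (c%:E * pushforward (mrestr (lrV R k) mQ) ph B)%E.
  move=> mB; rewrite /M /pushforward /mrestr; apply: cP.
  apply: measurableI => //; rewrite -[X in measurable X]setTI; exact: (mg).
have finM : fin_num_fun M.
  move=> B mB; rewrite ge0_fin_numE ?outer_measure_ge0//.
  apply: (@le_lt_trans _ _ (hausdorff k (@unit_cube R k))).
    exact: le_outer_measure.
  by rewrite cP// lrV_unit_cube mule1 ltry.
pose P : {finite_measure set _ -> \bar R} :=
  HB.pack M (Measure_isFinite.Build _ _ _ M finM).
exists (P mg mg mg mg).
  (* The set functions agree on all sets, not only on Borel ones, by isometry invariance of the
     outer measure. *)
  apply/funext => B; rewrite /P /= /M /pushforward /mrestr /hausdorff_borel /hausdorff_restr.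
  rewrite -(@hausdorff_isometry _ k _ n g); last first.
    by move=> x y _ _; rewrite /g opprD addrACA subrr add0r -mulmxBl enorm_mulmx_isometry.
  congr hausdorff; apply/seteqP.
split => [_ [x [Bx Qx] <-]|y [By [x Qx xE]]].
    by split=> //; exists x.
  by exists x => //; split=> //=; rewrite /g xE.
move=> f mf f0.
pose m2 : {measure set (borel R k) -> \bar R} := mrestr (lrV R k) mQ.
rewrite (@ge0_integral_scaled_measure _ _ _ _ (pushforward m2 ph) c)//; last exact: ltW.
congr (_ * _)%E; rewrite ge0_integral_pushforward//.
rewrite preimage_setT ge0_integral_mrestr//.
  exact: (measurableT_comp mf mg).
by move=> x; exact: f0.
Qed.

(** * Fourier transforms *)

Section fourier_finite.
Context (R : realType) (n : nat) (P : {finite_measure set (borel R n) -> \bar R}).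
Local Open Scope ring_scope.

Lemma integrable_bounded_finite (f : borel R n -> R) M :
  measurable_fun setT f -> (forall x, `|f x| <= M) ->
  P.-integrable setT (EFin \o f).
Proof.
move=> mf fM; apply: measurable_bounded_integrable => //.
  by rewrite -ge0_fin_numE ?fin_num_measure.
exists M; split; first exact: num_real.
by move=> N MN x _ /=; rewrite (le_trans (fM x))// ltW.
Qed.

Lemma integrable_cos_dotrv (w : 'rV[R]_n) (psi : R) :
  P.-integrable setT (fun x => (cos (psi + dotrv w x))%:E).
Proof.
apply: (@integrable_bounded_finite (fun x => cos (psi + dotrv w x)) 1).
  exact: measurable_cos_dotrv.
by move=> x; exact: cos_max.
Qed.

(** With [w = - (2 * pi) *: z], this is the real part of e^(i psi) times the transform at z; the
    phases 0 and - pi / 2 give its real and imaginary parts. *)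
Definition fcos (psi : R) (w : 'rV[R]_n) : R :=
  fine (\int[P]_x (cos (psi + dotrv w x))%:E)%E.

Lemma fcosE psi w : (\int[P]_x (cos (psi + dotrv w x))%:E = (fcos psi w)%:E)%E.
Proof.
rewrite /fcos fineK//; apply: integrable_fin_num => //.
exact: integrable_cos_dotrv.
Qed.

Lemma fourierE (z : 'rV[R]_n) :
  fourier P z = (fcos 0 (- (2 * pi) *: z) +i* fcos (- (pi / 2)) (- (2 * pi) *: z))%C.
Proof.
have dE (x : 'rV[R]_n) : dotrv (- (2 * pi) *: z) x = - (2 * pi * dotrv z x).
  by rewrite !dotrvE -scalemxAl mxE mulNr.
rewrite /fourier /integralC /fcos; congr (fine _ +i* fine _)%C.
  by apply: eq_integral => x _; rewrite add0r dE.
by apply: eq_integral => x _; rewrite addrC cosBpihalf dE.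
Qed.

Lemma fcos_shift psi w :
  fcos psi w = cos psi * fcos 0 w - sin psi * fcos (- (pi / 2)) w.
Proof.
apply: EFin_inj; rewrite EFinB !EFinM -!fcosE.
have ic q := integrable_cos_dotrv w q.
rewrite -!integralZl// -integralB//; last 2 first.
- exact: integrableZl.
- exact: integrableZl.
apply: eq_integral => x _; rewrite -!EFinM -EFinB; congr EFin.
by rewrite add0r [- _ + _]addrC cosBpihalf cosD.
Qed.

(** The real part of a rotated complex number is at most its modulus. The algebra is Lagrange's
    identity (ca - sb)^2 + (cb + sa)^2 = (a^2 + b^2)(c^2 + s^2). *)
Lemma fcos_le_normc psi (z : 'rV[R]_n) :
  fcos psi (- (2 * pi) *: z) <= Normc.normc (fourier P z).
Proof.
rewrite fourierE fcos_shift; set a := fcos 0 _; set b := fcos _ _.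
rewrite /Normc.normc; apply: le_trans (ler_norm _) _.
rewrite -sqrtr_sqr ler_wsqrtr//.
have := cos2Dsin2 psi; set c := cos psi; set s := sin psi => cs.
have : 0 <= (c * b + s * a) ^+ 2 by exact: sqr_ge0.
have -> : a ^+ 2 + b ^+ 2 = (a ^+ 2 + b ^+ 2) * (c ^+ 2 + s ^+ 2) by rewrite cs mulr1.
by move=> ?; rewrite -subr_ge0 (_ : _ - _ = (c * b + s * a) ^+ 2)//; ring.
Qed.

Lemma ge_fcos (X : set (borel R n)) (kappa psi : R) (w : 'rV[R]_n) :
  measurable X -> P (~` X) = 0%E -> 0 <= kappa ->
  (forall x, X x -> kappa <= cos (psi + dotrv w x)) ->
  kappa * fine (P setT) <= fcos psi w.
Proof.
move=> mX X0 k0 hX; rewrite -lee_fin -fcosE EFinM fineK ?fin_num_measure//.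
have i1 : P.-integrable setT (fun x : borel R n => (cos (psi + dotrv w x))%:E).
  exact: integrable_cos_dotrv.
have -> : (P setT = P X)%E.
  have := measureU P mX (measurableC mX) (setICr X).
  by rewrite setUv => ->; rewrite [Y in (_ + Y)%E]X0 adde0.
rewrite -(setUv X) integral_setU_EFin//; last 3 first.
- exact: measurableC.
- by rewrite setUv; apply/measurable_EFinP; exact: measurable_int i1.
- by rewrite /disj_set setICr.
rewrite (@null_set_integral _ _ _ _ (~` X))//; last 2 first.
- exact: measurableC.
- by apply: measurable_funTS; exact: measurable_int i1.
rewrite adde0 -integral_cst//; apply: le_integral => //.
- apply: (integrableS measurableT) => //.
  by apply: (@integrable_bounded_finite (cst kappa) `|kappa|).
- exact: (integrableS measurableT mX (@subsetT _ _) i1).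
- by move=> x Xx; rewrite lee_fin; apply: hX; rewrite inE in Xx.
Qed.

(** Such a dependence on the phase says that the transform at z is K e^(i phi). *)
Lemma normc_fourier_cos (K phi : R) (z : 'rV[R]_n) :
  (forall psi, fcos psi (- (2 * pi) *: z) = K * cos (psi + phi)) ->
  Normc.normc (fourier P z) = `|K|.
Proof.
move=> h; rewrite fourierE !h /Normc.normc.
rewrite add0r [- _ + _]addrC cosBpihalf !exprMn -mulrDr cos2Dsin2 mulr1.
exact: sqrtr_sqr.
Qed.

End fourier_finite.

Lemma normc_fourier_affine_cube (R : realType) k n (A : 'M[R]_(k, n)) (b : 'rV[R]_n)
    (c : R) (P : {finite_measure set (borel R n) -> \bar R}) (z : 'rV[R]_n) :
  is_affine_cube_measure A b c P ->
  Normc.normc (fourier P z) =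
    `|c * \prod_(i < k) sinc (- (2 * pi) * (z *m A^T) 0 i)|.
Proof.
move=> hP; set w := - (2 * pi) *: z.
pose u := w *m A^T.
have uE i : u 0 i = - (2 * pi) * (z *m A^T) 0 i by rewrite /u /w -scalemxAl mxE.
under eq_bigr do rewrite -uE.
have PT := affine_cube_measure_setT hP.
apply: (@normc_fourier_cos _ _ _ _ (dotrv w b + \sum_i u 0 i / 2)) => psi.
apply: EFin_inj; rewrite -fcosE -/w.
have ic := integrable_cos_dotrv P w psi.
have i1 : P.-integrable setT (fun=> 1%:E : \bar R).
  by apply: (@integrable_bounded_finite _ _ _ (cst 1) 1) => // x; rewrite normr1.
(* The cube formula concerns [1 + cos]; the summand 1 contributes the total mass [c] on both sides
   and is cancelled at the end. *)
have : (\int[P]_x (1 + cos (psi + dotrv w x))%:E =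
    P setT + \int[P]_x (cos (psi + dotrv w x))%:E)%E.
  under eq_integral do rewrite EFinD.
  by rewrite integralD// integral_cst// mul1e.
rewrite hP; last 2 first.
- by apply/measurable_EFinP; apply: measurable_funD => //; exact: measurable_cos_dotrv.
- by move=> x; rewrite lee_fin cos_addr1_ge0.
have dE (x : 'rV[R]_k) : psi + dotrv w (b + x *m A) = (psi + dotrv w b) + dotrv u x.
  by rewrite dotrvDr dotrv_mulmx addrA.
under eq_integral do rewrite dE.
rewrite integral_cos_unit_cube PT fcosE -EFinM -EFinD => /eqP; rewrite eqe => /eqP.
rewrite mulrDr mulr1 => /addrI <-; congr EFin.
by rewrite -mulrA addrA.
Qed.

(** In the rank factorization of [A], padding [col_ebase A] with an identity block gives an
    invertible matrix whose first k rows are [A]; [M] is its transpose. The completion need not be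
    orthogonal, so norms in the new coordinates are only compared up to constants. *)
Lemma orthonormal_rows_completion (R : realType) k m (A : 'M[R]_(k, k + m)) :
  A *m A^T = 1%:M -> exists2 M : 'M[R]_(k + m), M \in unitmx &
    forall (z : 'rV[R]_(k + m)) i, (z *m M) 0 (lshift m i) = (z *m A^T) 0 i.
Proof.
move=> AA.
have rA : \rank A = k by apply/eqP; apply/row_freeP; exists A^T.
pose N : 'M[R]_(k + m) := block_mx (col_ebase A) 0 0 1%:M *m row_ebase A.
have uN : N \in unitmx.
  rewrite unitmx_mul row_ebase_unit andbT unitmxE det_ublock det1 mulr1.
  by rewrite -unitmxE col_ebase_unit.
have NA : usubmx N = A.
  rewrite -mul_usub_mx /block_mx col_mxKu -[RHS]mulmx_ebase rA.
  by rewrite pid_mx_row mul_mx_row mulmx1 mulmx0.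
exists N^T => [|z i]; first by rewrite unitmx_tr.
rewrite !mxE; apply: eq_bigr => j _; congr (_ * _).
by rewrite -[in RHS]NA !mxE.
Qed.

Lemma mulmx_coord_le_enorm (R : realType) m n (M : 'M[R]_(m, n)) :
  exists2 C : R, 0 < C & forall (z : 'rV[R]_m) i, `|(z *m M) 0 i| <= C * enorm z.
Proof.
exists (1 + \sum_j \sum_i `|M j i|).
  by rewrite ltr_pwDl// sumr_ge0// => j _; rewrite sumr_ge0.
move=> z i; rewrite mxE; apply: le_trans (ler_norm_sum _ _ _) _.
rewrite mulrDl mul1r -[leLHS]add0r lerD ?enorm_ge0// mulr_suml.
apply: ler_sum => j _; rewrite normrM mulrC.
apply: ler_pM => //; last exact: normr_le_enorm.
by rewrite (bigD1 i)//= lerDl sumr_ge0.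
Qed.

Lemma enorm_le_mulmx_coord (R : realType) n (M : 'M[R]_n) : M \in unitmx ->
  exists2 C : R, 0 < C & forall (z : 'rV[R]_n) (t : R), (forall i, `|(z *m M) 0 i| <= t) ->
    0 <= t -> enorm z <= C * t.
Proof.
move=> uM; exists (1 + \sum_j \sum_i `|invmx M i j|).
  by rewrite ltr_pwDl// sumr_ge0// => j _; rewrite sumr_ge0.
move=> z t zt t0; apply: le_trans (enorm_le_sum _) _.
rewrite mulrDl mul1r -[leLHS]add0r lerD// mulr_suml.
apply: ler_sum => j _; rewrite -{1}(mulmxK uM z) mxE.
apply: le_trans (ler_norm_sum _ _ _) _; rewrite mulr_suml; apply: ler_sum => i _.
by rewrite normrM mulrC; apply: ler_pM.
Qed.

(* Every point outside the support has a null rational ball around it, and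
   there are only countably many of these. *)
Lemma measure_setC_spt (R : realType) n (nu : {measure set (borel R n) -> \bar R})
    (X : set 'rV[R]_n) :
  closed X -> spt nu `<=` X -> nu (~` X : set (borel R n)) = 0%E.
Proof.
move=> cX sX.
pose B (p : 'rV[rat]_n * nat) : set 'rV[R]_n :=
  ball (map_mx ratr p.1 : 'rV[R]_n) p.2.+1%:R^-1.
pose F q : set (borel R n) := if unpickle q is Some p then
  (if nu (B p) == 0%E then B p else set0) else set0.
have mX : measurable (~` X : set (borel R n)) by apply: borel_open; exact: closed_openC.
have mB p : measurable (B p : set (borel R n)).
  by apply: borel_open; apply: ball_open; rewrite invr_gt0.
apply/eqP; rewrite -measure_le0.
have FX : ~` X `<=` \bigcup_q F q.
  move=> y /(contra_not (@sX y)) /existsNP[U] /not_implyP[oU] /not_implyP[Uy].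
  move=> /negP; rewrite -leNgt measure_le0 => /eqP nU.
  move: Uy; rewrite {1}(open_rV_ball oU) => -[p _ [py pU]].
  exists (pickle p) => //; rewrite /F pickleK ifT//.
  rewrite -measure_le0 -nU; apply: le_measure => //; rewrite inE.
    exact: mB.
  exact: borel_open.
have mF q : measurable (F q).
  by rewrite /F; case: unpickle => [p|//]; case: ifP.
have F0 q : nu (F q) = 0%E.
  rewrite /F; case: unpickle => [p|]; last exact: measure0.
  by case: ifPn => [/eqP//|_]; exact: measure0.
apply: le_trans (measure_sigma_subadditive _ mF mX FX) _.
by rewrite eseries0// => q _ _; exact: F0.
Qed.

(** A nonnegative integral is a supremum over simple functions below the integrand, and this family
    grows with the integrand. It applies to integrands built from the transform, with measurability
    kept on the side of the explicit comparison functions. *)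
Lemma ge0_le_integral_nonmeasurable (R : realType) d (T : measurableType d)
    (mu : {measure set T -> \bar R}) (f g : T -> \bar R) :
  (forall x, 0 <= f x)%E -> (forall x, f x <= g x)%E ->
  (\int[mu]_x f x <= \int[mu]_x g x)%E.
Proof.
move=> f0 fg; rewrite !ge0_integralTE//; last by move=> x; exact: le_trans (f0 x) (fg x).
apply: ereal_sup_le => _ [h hf <-]; exists h => // x.
exact: le_trans (hf x) (fg x).
Qed.

(** * Energy integrals *)

Lemma powR_unbounded (R : realType) (s r : R) : 0 < s ->
  exists2 x : R, 1 <= x & r <= x `^ s.
Proof.
move=> s0; exists (Num.max 1 r `^ s^-1).
  apply: (@le_trans _ _ (1 `^ s^-1)); first by rewrite powR1.
  apply: ge0_ler_powR; rewrite ?nnegrE ?ler01//; first by rewrite invr_ge0 ltW.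
    by rewrite le_max ler01.
  by rewrite le_max lexx.
rewrite -powRrM mulVf ?gt_eqF// powRr1 ?le_max ?ler01//.
by rewrite lexx orbT.
Qed.

(** The exponent may have either sign: the lower bound on x serves [0 <= beta], the upper bound
    serves negative [beta]. *)
Lemma powR_bounded_below (R : realType) (a b beta : R) : 0 < a -> 0 < b ->
  exists2 c : R, 0 < c & forall t x : R, 0 < t -> a * t <= x <= b * t ->
    c * t `^ beta <= x `^ beta.
Proof.
move=> a0 b0; exists (Num.min (a `^ beta) (b `^ beta)).
  by rewrite lt_min !powR_gt0.
move=> t x t0 /andP[ax xb].
have x0 : 0 < x by apply: lt_le_trans ax; rewrite mulr_gt0.
have [aw bw tw] : [/\ 0 <= a, 0 <= b & 0 <= t] by split; exact: ltW.
have atw : 0 <= a * t by exact: mulr_ge0.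
have btw : 0 <= b * t by exact: mulr_ge0.
have xw := ltW x0.
have [beta0|/ltW beta0] := leP 0 beta.
  apply: (@le_trans _ _ ((a * t) `^ beta)).
    rewrite powRM//; apply: ler_wpM2r; first exact: powR_ge0.
    by rewrite ge_min lexx.
  by apply: ge0_ler_powR.
apply: (@le_trans _ _ ((b * t) `^ beta)).
  rewrite powRM//; apply: ler_wpM2r; first exact: powR_ge0.
  by rewrite ge_min lexx orbT.
have bt0 : 0 < b * t by exact: mulr_gt0.
rewrite -(opprK beta) !(@powRN _ _ (- beta)) lef_pV2 ?posrE ?powR_gt0//.
by apply: ge0_ler_powR => //; rewrite oppr_ge0.
Qed.

(* On the preimage of [-delta, delta]^k x [N, 2N]^m the integrand is at least of
   order N^beta, while this set has measure of order N^m. *)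
Lemma integral_powR_pinfty (R : realType) k m (M : 'M[R]_(k + m))
    (F : 'rV[R]_(k + m) -> R) (delta kappa p beta : R) :
  M \in unitmx -> (0 < m)%N -> 0 < delta <= 1 -> 0 < kappa -> 0 <= p -> - m%:R < beta ->
  (forall z, 0 <= F z) ->
  (forall z, (forall i : 'I_k, `|(z *m M) 0 (lshift m i)| <= delta) -> kappa <= F z) ->
  (\int[lrV R (k + m)]_z (F z `^ p * enorm (z : 'rV[R]_(k + m)) `^ beta)%:E = +oo)%E.
Proof.
move=> uM m0 /andP[d0 d1] k0 p0 hbeta F0 Fk.
have [C1 C10 hC1] := mulmx_coord_le_enorm M.
have [C2 C20 hC2] := enorm_le_mulmx_coord uM.
(* On the region integrated over, [N / C1 <= enorm z <= C2 * 2 * N], where the upper bound uses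
   [delta <= 1 <= N]. *)
have [c c0 hc] := @powR_bounded_below R C1^-1 (C2 * 2) beta
  (ltac:(by rewrite invr_gt0)) (ltac:(by rewrite mulr_gt0)).
have [c' c'0 hc'] := ge0_integral_lrV_mulmx uM.
(* All factors independent of N: the lower bound obtained is K N^(beta + m), and N is then chosen to
   make it exceed r. *)
pose K := kappa `^ p * c * c' * (2 * delta) ^+ k.
have K0 : 0 < K by rewrite !mulr_gt0 ?powR_gt0// exprn_gt0// mulr_gt0.
apply/eqyP => r r0.
have bm0 : 0 < beta + m%:R by rewrite -ltrBlDr sub0r.
have [N N1 rN] := powR_unbounded (r / K) bm0.
have N0 : 0 < N by exact: lt_le_trans N1.
pose lo (i : 'I_(k + m)) := match fintype.split i with inl _ => - delta | inr _ => N end.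
pose hi (i : 'I_(k + m)) := match fintype.split i with inl _ => delta | inr _ => 2 * N end.
have lohi i : lo i <= hi i.
  by rewrite /lo /hi; case: (fintype.split i) => _; lra.
pose S := rectV (fun i => `[lo i, hi i]%classic).
have mS : measurable S by exact: measurable_rectV.
have SV : lrV R (k + m) S = ((2 * delta) ^+ k * N ^+ m)%:E.
  rewrite lrV_box// big_split_ord/=; congr (_ * _)%:E.
    rewrite (eq_bigr (fun=> 2 * delta)) ?prodr_const ?card_ord// => i _.
    by rewrite /lo /hi -/(unsplit (inl i)) unsplitK; ring.
  rewrite (eq_bigr (fun=> N)) ?prodr_const ?card_ord// => i _.
  by rewrite /lo /hi -/(unsplit (inr i)) unsplitK; ring.
pose g (w : borel R (k + m)) : \bar R := ((kappa `^ p * (c * N `^ beta)) * \1_S w)%:E.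
have g0 w : (0 <= g w)%E.
  by rewrite lee_fin !mulr_ge0// ?powR_ge0// ltW.
have mg : measurable_fun setT g.
  by apply/measurable_EFinP; apply: measurable_funM.
apply: (@le_trans _ _ (\int[lrV R (k + m)]_z g ((z : 'rV[R]_(k + m)) *m M))%E); last first.
  apply: ge0_le_integral_nonmeasurable => [z|z]; first exact: g0.
  rewrite lee_fin indicE; have [zS|zS] := boolP (_ \in _); last first.
    by rewrite mulr0 mulr_ge0// powR_ge0.
  rewrite mulr1; move: zS; rewrite inE => zS.
  have zlo i : `|(z *m M) 0 (lshift m i)| <= delta.
    have := zS (lshift m i); rewrite /= in_itv/= /lo /hi.
    by rewrite -/(unsplit (inl i)) unsplitK ler_norml.
  have zhi i : N <= (z *m M) 0 (rshift k i) <= 2 * N.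
    have := zS (rshift k i); rewrite /= in_itv/= /lo /hi.
    by rewrite -/(unsplit (inr i)) unsplitK.
  apply: ler_pM; rewrite ?powR_ge0//.
  - by rewrite mulr_ge0 ?powR_ge0// ltW.
  - by apply: ge0_ler_powR; rewrite ?nnegrE ?F0//; [exact: ltW|exact: Fk].
  - apply: hc => //; apply/andP; split.
      rewrite ler_pdivrMl//; apply: le_trans (hC1 _ (rshift k (Ordinal m0))).
      by rewrite (le_trans _ (ler_norm _))//; have /andP[] := zhi (Ordinal m0).
    rewrite -mulrA; apply: hC2; last by rewrite mulr_ge0// ltW.
    move=> i; rewrite -(splitK i); case: (fintype.split i) => j /=.
      by apply: le_trans (zlo j) _; lra.
    have /andP[h1 h2] := zhi j; rewrite ger0_norm//.
    by apply: le_trans h1; exact: ltW.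
rewrite hc'// /g.
under eq_integral do rewrite EFinM.
have mI : measurable_fun setT (fun w : borel R (k + m) => (\1_S w : R)%:E).
  exact/measurable_EFinP.
have c1 : (0 <= (kappa `^ p * (c * N `^ beta))%:E)%E.
  by rewrite lee_fin !mulr_ge0 ?powR_ge0// ltW.
rewrite (ge0_integralZl _ _ mI)//.
have Nw := ltW N0.
have -> : (\int[lrV R (k + m)]_w (\1_S w : R)%:E = ((2 * delta) ^+ k * N ^+ m)%:E)%E.
  by rewrite integral_indicT//; exact: SV.
rewrite -!EFinM lee_fin.
move: rN; rewrite ler_pdivrMr// => rN; apply: (le_trans rN).
rewrite powRD; last by rewrite gt_eqF ?implybT.
rewrite powR_mulrn// /K le_eqVlt; apply/orP; left; apply/eqP; ring.
Qed.

(** * Integrable majorants from dyadic decompositions *)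

Lemma nneseries_geometric_lty (R : realType) (C r : R) : 0 <= C -> 0 <= r < 1 ->
  (\sum_(q <oo) (C * r ^+ q)%:E < +oo)%E.
Proof.
move=> C0 /andP[r0 r1].
have r1' : 0 < 1 - r by rewrite subr_gt0.
have Cr q : 0 <= C * r ^+ q by rewrite mulr_ge0// exprn_ge0.
apply: (@le_lt_trans _ _ (C / (1 - r))%:E); last by rewrite ltry.
apply: lime_le; first by apply: is_cvg_nneseries => q *; rewrite lee_fin.
apply: nearW => N; rewrite sumEFin lee_fin -mulr_sumr; apply: ler_wpM2l => //.
rewrite -[leRHS]mul1r ler_pdivlMr// big_mkord mulrC -opprB mulNr -subrX1 opprB.
by rewrite lerBlDr lerDl exprn_ge0.
Qed.

Section dominated_by_series.
Context (R : realType) d (T : measurableType d) (mu : {measure set T -> \bar R}).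
Context (a : nat -> R) (B : nat -> set T).
Hypothesis a0 : forall q, 0 <= a q.
Hypothesis mB : forall q, measurable (B q).

(** A majorant for any function bounded by some [a q] with x in [B q]. The sets may overlap, so
    nested boxes can stand in for dyadic shells. *)
Definition indic_series (x : T) : \bar R := (\sum_(q <oo) (a q * \1_(B q) x)%:E)%E.

Let term_ge0 q x : (0 <= (a q * \1_(B q) x)%:E)%E.
Proof. by rewrite lee_fin mulr_ge0. Qed.

Let mterm q : measurable_fun setT (fun x => (a q * \1_(B q) x)%:E).
Proof. by apply/measurable_EFinP; exact: measurable_funM. Qed.

Lemma indic_series_ge0 x : (0 <= indic_series x)%E.
Proof. by apply: nneseries_ge0 => *; exact: term_ge0. Qed.

Lemma measurable_indic_series : measurable_fun setT indic_series.
Proof.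
apply: (@ge0_emeasurable_sum _ _ _ _ _ xpredT) => [q x _ _|q _]; first exact: term_ge0.
exact: mterm.
Qed.

Lemma indic_series_ge q x : B q x -> ((a q)%:E <= indic_series x)%E.
Proof.
move=> Bx; apply: le_trans (nneseries_lim_ge q.+1 _); last by move=> *; exact: term_ge0.
rewrite big_nat_recr//= indicE mem_set// mulr1 leeDr// sume_ge0//.
Qed.

Lemma integral_indic_series :
  (\int[mu]_x indic_series x = \sum_(q <oo) (a q)%:E * mu (B q))%E.
Proof.
rewrite integral_nneseries//.
apply: eq_eseriesr => q _; under eq_integral do rewrite EFinM.
have mI : measurable_fun setT (fun x : T => (\1_(B q) x : R)%:E).
  exact/measurable_EFinP.
by rewrite (ge0_integralZl _ _ mI)// ?lee_fin// integral_indicT.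
Qed.

End dominated_by_series.

Lemma two_powR_gt1 (R : realType) (x : R) : 0 < x -> 1 < 2 `^ x :> R.
Proof.
move=> x0; apply: (@le_lt_trans _ _ (1 `^ x)); first by rewrite powR1.
by apply: gt0_ltr_powR => //; rewrite ?nnegrE ?ltr1n.
Qed.

Lemma exists_pow2_ge (R : realType) (t : R) : exists q, t <= 2 ^+ q.
Proof.
exists (Num.truncn t).+1; apply: (@le_trans _ _ (Num.truncn t).+1%:R).
  by apply: ltW; exact: truncnS_gt.
by rewrite -natrX ler_nat ltnW// ltn_expl.
Qed.

Definition max1 (R : realType) (t : R) : R := Num.max 1 `|t|.

Lemma max1_ge1 (R : realType) (t : R) : 1 <= max1 t.
Proof. by rewrite /max1 le_max lexx. Qed.

Lemma max1_gt0 (R : realType) (t : R) : 0 < max1 t.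
Proof. exact: lt_le_trans (max1_ge1 t). Qed.

Lemma measurable_max1_powR (R : realType) (b : R) :
  measurable_fun setT (fun t : R => max1 t `^ b).
Proof.
apply: (measurableT_comp (measurable_powR b)).
by apply: measurable_maxr => //; exact: normr_measurable.
Qed.

Lemma le_powRN (R : realType) (b x y : R) : 0 <= b -> 0 < x -> x <= y ->
  y `^ (- b) <= x `^ (- b).
Proof.
move=> b0 x0 xy; have y0 : 0 < y by exact: lt_le_trans xy.
rewrite !powRN lef_pV2 ?posrE ?powR_gt0//.
by apply: ge0_ler_powR => //; rewrite nnegrE ltW.
Qed.

(** Where 2^q <= |t| <= 2^(q+1) the integrand is at most 2^(-bq), and the enclosing interval has
    length 4 * 2^q: a geometric series of ratio 2^(1-b). *)
Lemma integral_max1_powR_lty (R : realType) (b : R) : 1 < b ->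
  (\int[@lebesgue_measure R]_t (max1 (t : R) `^ (- b))%:E < +oo)%E.
Proof.
move=> b1; have b0 : 0 < b by exact: lt_trans b1.
pose a q : R := (2 `^ (- b)) ^+ q.
pose B q : set (measurableTypeR R) := `[- 2 ^+ q.+1, 2 ^+ q.+1]%classic.
have a0 q : 0 <= a q by rewrite exprn_ge0// powR_ge0.
have mB q : measurable (B q) by exact: measurable_itv.
have p2 q : 0 <= (2 : R) ^+ q by rewrite exprn_ge0.
apply: (@le_lt_trans _ _ (\int[@lebesgue_measure R]_t indic_series a B t)%E).
  apply: ge0_le_integral_nonmeasurable => t; first by rewrite lee_fin powR_ge0.
  have ext : exists q, `|t : R| <= 2 ^+ q.+1.
    by have [q h] := exists_pow2_ge `|t : R|; exists q; rewrite (le_trans h)// ler_eXn2l// ltr1n.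
  case: (ex_minnP ext) => q tq qmin.
  apply: (le_trans _ (indic_series_ge a0 _)); last first.
    by rewrite /B /= in_itv/= -ler_norml; exact: tq.
  rewrite lee_fin /a -powR_mulrn ?powR_ge0// powRAC powR_mulrn//.
  apply: le_powRN; rewrite ?exprn_gt0 ?(ltW b0)//.
  case: q tq qmin => [|q] _ qmin; first by rewrite expr0 max1_ge1.
  rewrite /max1 le_max; apply/orP; right.
  by rewrite leNgt; apply/negP => /ltW /qmin; rewrite ltnn.
rewrite integral_indic_series//.
rewrite (@eq_eseriesr _ _ (fun q => (4 * (2 `^ (- b) * 2) ^+ q)%:E)).
  apply: nneseries_geometric_lty => //; apply/andP; split.
    by rewrite mulr_ge0// powR_ge0.
  have b1' : 0 < b - 1 by rewrite subr_gt0.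
  rewrite powRN mulrC ltr_pdivrMr ?powR_gt0// mul1r.
  have := two_powR_gt1 b1'; rewrite powRB; last by rewrite pnatr_eq0 implybT.
  by rewrite powRr1// ltr_pdivlMr// mul1r.
move=> q _; transitivity ((a q)%:E * (2 * 2 ^+ q.+1)%:E)%E.
  congr (_ * _)%E; rewrite /B /= lebesgue_measure_itv/= lte_fin ifT; last first.
    by rewrite gtrN// exprn_gt0.
  by rewrite -EFinD; congr EFin; ring.
by rewrite -EFinM; congr EFin; rewrite /a exprMn exprS; ring.
Qed.

Lemma lte_prode_pinfty (R : realType) (I : Type) (s : seq I) (g : I -> \bar R) :
  (forall i, 0 <= g i)%E -> (forall i, g i < +oo)%E -> (\prod_(i <- s) g i < +oo)%E.
Proof.
move=> g0 goo; elim: s => [|i s ih]; first by rewrite big_nil ltry.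
by rewrite big_cons lte_mul_pinfty// ge0_fin_numE.
Qed.

Lemma enorm_eq0 (R : realType) n (x : 'rV[R]_n) : (forall i, x 0 i = 0) -> enorm x = 0.
Proof. by move=> x0; rewrite /enorm /dotrv big1 ?sqrtr0// => i _; rewrite x0 mulr0. Qed.

Lemma exists_dyadic_shell (R : realType) n (w : 'rV[R]_n) i0 :
  w 0 i0 != 0 -> (forall i, `|w 0 i| <= 1) ->
  exists2 q : nat, (forall i, `|w 0 i| <= 2 ^- q) & exists i, 2 ^- q.+1 <= `|w 0 i|.
Proof.
move=> wi0 w1; pose E q := [exists i, 2 ^- q.+1 <= `|w 0 i|].
have exE : exists q, E q.
  have [q hq] := exists_pow2_ge `|w 0 i0|^-1.
  exists q; apply/existsP; exists i0.
  rewrite -[leRHS]invrK lef_pV2 ?posrE ?exprn_gt0 ?invr_gt0 ?normr_gt0//.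
  by apply: (le_trans hq); rewrite ler_eXn2l// ltr1n.
case: (ex_minnP exE) => q /existsP Eq qmin; exists q => // i.
case: q qmin Eq => [|q] qmin _; first by rewrite expr0 invr1.
rewrite leNgt; apply/negP => /ltW qi.
have /qmin : E q by apply/existsP; exists i.
by rewrite ltnn.
Qed.

(** Put w = zM. Where all |w_i| <= 1, the singularity is summed over dyadic boxes, convergent
    because a < k + m. Elsewhere every [max1] of a coordinate is at most a constant times |z|, so
    |z|^(-a) splits into factors of exponent -a/m over the last m coordinates, each integrable
    because m < a; the bound on F handles the first k. *)
Lemma integral_powR_lty (R : realType) k m (M : 'M[R]_(k + m))
    (F : 'rV[R]_(k + m) -> R) (c p a : R) :
  M \in unitmx -> (0 < m)%N -> m%:R < a < (k + m)%:R -> 2 <= p -> 0 <= c ->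
  (forall z, 0 <= F z) ->
  (forall z, F z <= c * \prod_(i < k) (max1 ((z *m M) 0 (lshift m i)))^-1) ->
  (\int[lrV R (k + m)]_z (F z `^ p * enorm (z : 'rV[R]_(k + m)) `^ (- a))%:E < +oo)%E.
Proof.
move=> uM m0 /andP[ma akm] p2 c0 F0 Fc.
have mR0 : 0 < m%:R :> R by rewrite ltr0n.
have a0 : 0 < a by exact: lt_trans ma.
have [C C0 hC] := mulmx_coord_le_enorm M.
have [c' c'0 hc'] := ge0_integral_lrV_mulmx uM.
have Cw := ltW C0.
pose K := c `^ p * C `^ a.
have K0 : 0 <= K by rewrite mulr_ge0// powR_ge0.
(* The power -a of 2^-(q+1), the lower bound for the largest coordinate in the q-th shell. *)
pose aq q : R := (2 `^ a) ^+ q.+1.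
have aq0 q : 0 <= aq q by rewrite exprn_ge0// powR_ge0.
pose B q : set (borel R (k + m)) := rectV (fun=> `[- 2 ^- q, 2 ^- q]%classic).
have mB q : measurable (B q) by exact: measurable_rectV.
pose e (i : 'I_(k + m)) : R :=
  match fintype.split i with inl _ => - 2%:R | inr _ => - (a / m%:R) end.
have me i : measurable_fun setT (fun t : R => max1 t `^ e i).
  exact: measurable_max1_powR.
pose G2 (w : borel R (k + m)) : R := \prod_i max1 ((w : 'rV[R]_(k + m)) 0 i) `^ e i.
have G20 w : 0 <= G2 w by rewrite prodr_ge0// => i _; rewrite powR_ge0.
pose H (w : borel R (k + m)) : \bar R := (indic_series aq B w + (G2 w)%:E)%E.
have H0 w : (0 <= H w)%E by rewrite adde_ge0// ?lee_fin// indic_series_ge0.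
have mS : measurable_fun setT (indic_series aq B) by exact: measurable_indic_series.
have mG2 : measurable_fun setT (fun w => (G2 w)%:E).
  apply/measurable_EFinP; exact: (measurable_prod_coord me).
have mH : measurable_fun setT H by exact: emeasurable_funD.
have key z : ((F z `^ p * enorm z `^ (- a))%:E <= K%:E * H (z *m M))%E.
  have KH0 : (0 <= K%:E * H (z *m M))%E by rewrite mule_ge0.
  (* At the origin the integrand vanishes by convention, since 0 to a nonzero real power is 0. *)
  have [z0|znz] := eqVneq (enorm z) 0.
    by rewrite z0 powR0 ?mulr0// oppr_eq0 gt_eqF.
  have ez0 : 0 < enorm z by rewrite lt0r znz enorm_ge0.
  set w := z *m M.
  pose G := \prod_(i < k) (max1 (w 0 (lshift m i)))^-1.
  have G0 : 0 < G by apply: prodr_gt0 => i _; rewrite invr_gt0 max1_gt0.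
  have Gw := ltW G0.
  have G1 : G <= 1.
    by apply: prodr_ile1 => i _; rewrite invr_ge0 (ltW (max1_gt0 _)) invf_le1 ?max1_ge1 ?max1_gt0.
  (* Since [G <= 1] and [2 <= p], the power p of [G] is at most its square. *)
  have FG : F z `^ p <= c `^ p * G ^+ 2.
    apply: (@le_trans _ _ ((c * G) `^ p)).
      have p0 : 0 <= p by apply: le_trans p2.
      have cG0 : 0 <= c * G by exact: mulr_ge0.
      apply: (ge0_ler_powR p0); rewrite ?nnegrE; [exact: F0|exact: cG0|exact: Fc].
    rewrite powRM//; apply: ler_wpM2l; first exact: powR_ge0.
    rewrite -powR_mulrn//; apply: ger_powR => //; exact/andP.
  have Fnear : F z `^ p <= c `^ p.
    apply: (le_trans FG); rewrite ler_piMr ?powR_ge0// expr_le1//.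
  have ge_near h : 0 < h -> h <= C * enorm z -> enorm z `^ (- a) <= C `^ a * h `^ (- a).
    move=> h0 hz; have hw := ltW h0.
    apply: (@le_trans _ _ ((C^-1 * h) `^ (- a))).
      apply: le_powRN; first exact: ltW.
        by rewrite mulr_gt0// invr_gt0.
      by rewrite ler_pdivrMl.
    by rewrite powRM ?invr_ge0// -powR_inv1// -powRrM mulN1r opprK.
  have [w1|] := pselect (forall i, `|w 0 i| <= 1).
    have [i0 wi0] : exists i0, w 0 i0 != 0.
      apply: contrapT => /forallNP h; move/eqP : znz; apply.
      have w0 : w = 0.
        by apply/rowP => i; rewrite [RHS]mxE; apply/eqP; have /negP := h i; rewrite negbK.
      apply: enorm_eq0 => i; rewrite -(mulmxK uM z) -/w w0 mul0mx mxE//.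
    have [q wq [i wi]] := exists_dyadic_shell wi0 w1.
    have Bw : B q w by move=> j; rewrite /= in_itv/= -ler_norml.
    apply: (@le_trans _ _ (K%:E * (aq q)%:E)%E).
      rewrite -EFinM lee_fin /K -mulrA; apply: ler_pM; rewrite ?powR_ge0//.
      have h := ge_near (2 ^- q.+1) _ (le_trans wi (hC z i)).
      apply: (le_trans (h _)); first by rewrite invr_gt0 exprn_gt0.
      rewrite le_eqVlt; apply/orP; left; apply/eqP; congr (_ * _).
      rewrite /aq -powR_inv1 ?exprn_ge0// -powRrM mulN1r opprK.
      by rewrite -[2 ^+ q.+1]powR_mulrn// powRAC powR_mulrn ?powR_ge0.
    apply: lee_wpmul2l; first by rewrite lee_fin.
    have aS : ((aq q)%:E <= indic_series aq B w)%E by exact: indic_series_ge.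
    by apply: (le_trans aS); apply: leeDl; rewrite lee_fin.
  move=> /existsNP[i0 /negP]; rewrite -ltNge => wi0.
  have far j : max1 (w 0 j) <= C * enorm z.
    rewrite /max1 ge_max; apply/andP; split; last exact: hC.
    exact: le_trans (ltW wi0) (hC z i0).
  apply: (@le_trans _ _ (K%:E * (G2 w)%:E)%E); last first.
    apply: lee_wpmul2l; first by rewrite lee_fin.
    by apply: leeDr; exact: indic_series_ge0.
  have am0 : 0 <= a / m%:R by rewrite divr_ge0 ?ltW.
  have fare : enorm z `^ (- a) <=
      C `^ a * \prod_(j < m) max1 (w 0 (rshift k j)) `^ (- (a / m%:R)).
    have -> : enorm z `^ (- a) = \prod_(j < m) enorm z `^ (- (a / m%:R)).
      rewrite prodr_const card_ord -powR_mulrn ?powR_ge0// -powRrM.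
      by congr (_ `^ _); rewrite mulNr divfK// gt_eqF.
    have -> : C `^ a = \prod_(j < m) C `^ (a / m%:R).
      rewrite prodr_const card_ord -powR_mulrn ?powR_ge0// -powRrM.
      by congr (_ `^ _); rewrite divfK// gt_eqF.
    rewrite -big_split/=; apply: ler_prod => j _; rewrite powR_ge0/=.
    have mw0 := max1_gt0 (w 0 (rshift k j)).
    apply: (@le_trans _ _ ((C^-1 * max1 (w 0 (rshift k j))) `^ (- (a / m%:R)))).
      apply: le_powRN => //; first by rewrite mulr_gt0// invr_gt0.
      by rewrite ler_pdivrMl//; exact: far.
    rewrite powRM ?invr_ge0//; last exact: ltW.
    by rewrite -powR_inv1// -powRrM mulN1r opprK.
  have G2E : G2 w = G ^+ 2 * \prod_(j < m) max1 (w 0 (rshift k j)) `^ (- (a / m%:R)).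
    rewrite /G2 big_split_ord/=; congr (_ * _).
      rewrite /G expr2 -big_split/=; apply: eq_bigr => i _.
      rewrite /e -/(unsplit (inl i)) unsplitK powRN powR_mulrn ?expr2 ?invfM//.
      exact: ltW (max1_gt0 _).
    by apply: eq_bigr => i _; rewrite /e -/(unsplit (inr i)) unsplitK.
  rewrite -EFinM lee_fin G2E /K.
  apply: (@le_trans _ _ ((c `^ p * G ^+ 2) *
    (C `^ a * \prod_(j < m) max1 (w 0 (rshift k j)) `^ (- (a / m%:R))))).
    by apply: ler_pM; rewrite ?powR_ge0.
  by rewrite le_eqVlt; apply/orP; left; apply/eqP; ring.
apply: (@le_lt_trans _ _ (\int[lrV R (k + m)]_z (K%:E * H ((z : 'rV[R]_(k + m)) *m M)))%E).
  apply: ge0_le_integral_nonmeasurable => z; last exact: key.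
  by rewrite lee_fin mulr_ge0 ?powR_ge0.
have mHM : measurable_fun setT (fun z : borel R (k + m) => H ((z : 'rV[R]_(k + m)) *m M)).
  exact: (measurableT_comp mH (@measurable_mulmx R _ _ M)).
rewrite (ge0_integralZl _ _ mHM)// ?lee_fin// hc'//.
have fin2 (x y : R) (u : \bar R) : 0 <= x -> 0 <= y -> (0 <= u -> u < +oo ->
    x%:E * (y%:E * u) < +oo)%E.
  move=> x0 y0 u0 uoo; have uf : u \is a fin_num by rewrite ge0_fin_numE.
  by rewrite -(fineK uf) -!EFinM ltry.
apply: fin2 => //; [exact: ltW|exact: integral_ge0|].
rewrite ge0_integralD//; last 2 first.
- by move=> w _; exact: indic_series_ge0.
- by move=> w _; rewrite lee_fin.
apply: lte_add_pinfty.
  rewrite integral_indic_series//.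
  (* The box [B q] has measure (2 * 2^-q)^(k+m), so consecutive terms have ratio 2^(a-k-m) < 1. *)
  rewrite (@eq_eseriesr _ _ (fun q => ((2 `^ a * 2 ^+ (k + m)) * (2 `^ a / 2 ^+ (k + m)) ^+ q)%:E)).
    apply: nneseries_geometric_lty; first by rewrite mulr_ge0 ?powR_ge0 ?exprn_ge0.
    rewrite divr_ge0 ?powR_ge0 ?exprn_ge0//= ltr_pdivrMr ?exprn_gt0// mul1r.
    have akm' : 0 < (k + m)%:R - a by rewrite subr_gt0.
    have := two_powR_gt1 akm'; rewrite powRB; last by rewrite pnatr_eq0 implybT.
    by rewrite powR_mulrn// ltr_pdivlMr ?powR_gt0// mul1r.
  move=> q _.
  transitivity ((aq q)%:E * ((2 * 2 ^- q) ^+ (k + m))%:E)%E.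
    congr (_ * _)%E; apply: etrans (lrV_box _) _.
      by move=> i; apply: (@le_trans _ _ 0); rewrite ?oppr_le0 invr_ge0 exprn_ge0.
    rewrite (eq_bigr (fun=> 2 * 2 ^- q)) ?prodr_const ?card_ord// => i _; ring.
  rewrite -EFinM; congr EFin; rewrite /aq exprMn exprMn exprS !exprVn -!exprM mulnC; ring.
rewrite (@ge0_integral_lrV_prod R (k + m) (fun i t => max1 t `^ e i))//; last first.
  by move=> i x; exact: powR_ge0.
apply: lte_prode_pinfty => i.
  by apply: integral_ge0 => t _; rewrite lee_fin powR_ge0.
rewrite /e; case: (fintype.split i) => _; apply: integral_max1_powR_lty.
  by rewrite ltr1n.
by rewrite ltr_pdivlMr// mul1r.
Qed.

(** * Fourier spectra *)

(** Read off from positivity: [1 + P * cos] is nonnegative for P = 1 and P = -1, hence so is its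
    integral, which for the phase - u / 2 equals [1 + P * sinc u]. *)
Lemma normr_sinc_le1 (R : realType) (u : R) : `|sinc u| <= 1.
Proof.
have h (P : R) : `|P| <= 1 -> 0 <= 1 + P * sinc u.
  move=> P1; rewrite -lee_fin.
  have := integral_cos01 u (- (u / 2)) P; rewrite addNr cos0 mulr1 => <-.
  apply: integral_ge0 => x _; rewrite lee_fin.
  set t := cos _; have : `|P * t| <= 1 by rewrite normrM mulr_ile1// cos_max.
  by rewrite ler_norml => /andP[? _]; rewrite -lerBlDl sub0r.
have := h 1; have := h (- 1); rewrite normrN normr1 lexx => /(_ isT) h1 /(_ isT) h2.
by rewrite ler_norml; apply/andP; split; lra.
Qed.

Lemma normr_sinc_le_max1 (R : realType) (t : R) :
  `|sinc (- (2 * pi) * t)| <= (max1 t)^-1.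
Proof.
have [t1|t1] := leP `|t| 1.
  by rewrite /max1 max_l// invr1 normr_sinc_le1.
have t0 : 0 < `|t| by exact: lt_trans t1.
rewrite /max1 max_r; last exact: ltW.
have pi2 := @pi_ge2 R.
have pi0 := @pi_gt0 R.
have tn0 : t != 0 by rewrite -normr_gt0.
rewrite /sinc mulf_eq0 oppr_eq0 mulf_eq0 (negbTE tn0) pnatr_eq0 (gt_eqF pi0)/=.
rewrite normrM normfV -[leRHS]mul1r; apply: ler_pM => //.
  exact: sin_max.
rewrite lef_pV2 ?posrE ?normr_gt0//; last first.
  by rewrite mulf_neq0 ?invr_eq0// mulf_neq0// oppr_eq0 mulf_neq0// gt_eqF.
have -> : - (2 * pi) * t / 2 = - (pi * t) by field.
rewrite normrN normrM ler_peMl// ger0_norm; last exact: ltW.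
by apply: le_trans pi2; rewrite ler1n.
Qed.

Lemma cos_near0_ge (R : realType) :
  exists2 eta : R, 0 < eta & forall t : R, `|t| <= eta -> 2^-1 <= cos t.
Proof.
have h : (2^-1 : R) < cos 0 by rewrite cos0 invf_lt1// ltr1n.
have := @continuous_cos R 0 _ (lt_nbhsr h).
move=> /nbhs_ballP[e /= e0 he]; exists (e / 2); first by rewrite divr_gt0.
move=> t te; apply: ltW; apply: he; rewrite /ball/= sub0r normrN.
by apply: le_lt_trans te _; rewrite ltr_pdivrMr// ltr_pMr// ltr1n.
Qed.

Section affine_cube.
Context (R : realType) (k m : nat) (A : 'M[R]_(k, k + m)) (b : 'rV[R]_(k + m)).
Hypothesis AA : A *m A^T = 1%:M.
Hypothesis m0 : (0 < m)%N.
Let X := [set b + x *m A | x in @unit_cube R k].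

(* On X the phase z.(x - b) only involves the coordinates z *m A^T. *)
Lemma normc_fourier_ge (nu : {finite_measure set (borel R (k + m)) -> \bar R}) :
  nu setT != 0%E -> spt nu `<=` X ->
  exists kappa delta, [/\ 0 < kappa, 0 < delta <= 1 &
    forall z : 'rV[R]_(k + m), (forall i, `|(z *m A^T) 0 i| <= delta) ->
      kappa <= Normc.normc (fourier nu z)].
Proof.
move=> nu0 sX; have cX : closed X by exact: closed_affine_cube.
have nuX : nu (~` X : set (borel R (k + m))) = 0%E by exact: measure_setC_spt.
have mX : measurable (X : set (borel R (k + m))).
  have oX : open (~` X) by exact: closed_openC.
  by have := measurableC (borel_open oX); rewrite setCK.
have [eta eta0 heta] := cos_near0_ge R.
have pi0 := @pi_gt0 R.
have D0 : 0 < 2 * pi * k.+1%:R :> R by rewrite !mulr_gt0.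
(* Half the total mass, because the cosine will be at least 1/2 on X. The second constant keeps the
   total phase, at most 2 pi k delta, below [eta]; [k.+1] keeps the denominator positive. *)
exists (2^-1 * fine (nu setT)), (Num.min 1 (eta / (2 * pi * k.+1%:R))).
split.
- rewrite mulr_gt0 ?invr_gt0// fine_gt0// lt0e nu0 measure_ge0/=.
  by rewrite -ge0_fin_numE ?fin_num_measure.
- by rewrite lt_min ltr01 divr_gt0//= ge_min lexx.
move=> z hz; set w := - (2 * pi) *: z.
(* This phase cancels the contribution of the base point [b]. *)
apply: le_trans (fcos_le_normc nu (- dotrv w b) z).
apply: (@ge_fcos _ _ nu X _ _ _ mX nuX); first by rewrite invr_ge0.
move=> _ [y Qy <-]; apply: heta.
rewrite dotrvDr addKr dotrv_mulmx.
apply: le_trans (ler_norm_sum _ _ _) _.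
apply: (@le_trans _ _ (\sum_(i < k) 2 * pi * (eta / (2 * pi * k.+1%:R)))).
  apply: ler_sum => i _; rewrite /w -scalemxAl mxE normrM.
  rewrite -[leRHS]mulr1; apply: ler_pM => //.
    have pp : 0 < 2 * pi :> R by rewrite mulr_gt0.
    rewrite normrM normrN (ger0_norm (ltW pp)) ler_pM2l//; apply: le_trans (hz i) _.
    by rewrite ge_min lexx orbT.
  by have /andP[? ?] := Qy i; rewrite ger0_norm.
rewrite sumr_const card_ord -[_ *+ k]mulr_natr.
have cancel_pi (P e q K : R) : P != 0 -> K != 0 -> 2 * P * (e / (2 * P * K)) * q = e * (q / K).
  by move=> P0 K0; field; rewrite P0 K0.
rewrite cancel_pi ?pnatr_eq0 ?gt_eqF//.
have kk : k%:R / k.+1%:R <= 1 :> R by rewrite ler_pdivrMr// mul1r ler_nat.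
by rewrite ler_piMr// ltW.
Qed.

Lemma energy_pinfty (nu : {finite_measure set (borel R (k + m)) -> \bar R}) (s theta : R) :
  nu setT != 0%E -> spt nu `<=` X -> 0 <= theta -> k%:R * theta < s ->
  energy s theta nu = +oo%E.
Proof.
move=> nu0 sX theta0 hs.
have [kappa [delta [kappa0 delta01 hk]]] := normc_fourier_ge nu0 sX.
have [M uM hM] := orthonormal_rows_completion AA.
rewrite /energy; have [t0|tn0] := eqVneq theta 0.
  have s0 : 0 < s by move: hs; rewrite t0 mulr0.
  have [C C0 hC] := mulmx_coord_le_enorm M.
  apply/eqyP => r r0.
  have [x x1 hx] := powR_unbounded (r / kappa ^+ 2) s0.
  have x0 : 0 < x by exact: lt_le_trans x1.
  (* In the new coordinates this point has u = 0, so the transform stays above [kappa]; the factor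
     [C] makes its norm at least x. *)
  pose w : 'rV[R]_(k + m) := (C * x) *: delta_mx 0 (rshift k (Ordinal m0)).
  pose z := w *m invmx M.
  have zM : z *m M = w by rewrite mulmxKV.
  have Fz : kappa <= Normc.normc (fourier nu z).
    apply: hk => i; rewrite -hM zM !mxE eq_sym eq_rlshift andbF mulr0 normr0.
    by case/andP: delta01 => /ltW.
  have ez : x <= enorm z.
    have := hC z (rshift k (Ordinal m0)); rewrite zM !mxE !eqxx mulr1.
    by rewrite ger0_norm ?ler_pM2l// mulr_ge0// ltW.
  apply: le_trans (ereal_sup_ubound _); last by exists z.
  rewrite lee_fin; apply: (@le_trans _ _ (kappa ^+ 2 * x `^ s)).
    by rewrite mulrC -ler_pdivrMr// exprn_gt0.
  have kw := ltW kappa0.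
  apply: ler_pM; rewrite ?exprn_ge0 ?powR_ge0//.
    by apply: lerXn2r => //; rewrite nnegrE// (le_trans kw).
  apply: ge0_ler_powR; rewrite ?nnegrE//; first exact: ltW.
    exact: ltW.
  exact: enorm_ge0.
have tp : 0 < theta by rewrite lt0r tn0.
rewrite -lrVE (@integral_powR_pinfty _ _ _ M _ delta kappa)//.
- by rewrite poweRyr.
- by rewrite divr_ge0.
(* The exponent s/theta - (k + m) exceeds -m exactly when s > k theta. *)
- by rewrite natrD ltrBrDr addrCA addNr addr0 ltr_pdivlMr.
- by move=> z; rewrite /Normc.normc; case: (fourier _ _) => x y; exact: sqrtr_ge0.
- by move=> z hz; apply: hk => i; rewrite -hM.
Qed.

End affine_cube.

Lemma fourier_spectrum_le (R : realType) k m (A : 'M[R]_(k, k + m)) b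
    (nu : {finite_measure set (borel R (k + m)) -> \bar R}) (theta : R) :
  A *m A^T = 1%:M -> (0 < m)%N -> 0 <= theta -> nu setT != 0%E ->
  spt nu `<=` [set b + x *m A | x in @unit_cube R k] ->
  (fourier_spectrum theta nu <= (k%:R * theta)%:E)%E.
Proof.
move=> AA m0 theta0 nu0 sX.
apply: ge_ereal_sup => _ [->|[s [s0 es] <-]]; first by rewrite lee_fin mulr_ge0.
rewrite lee_fin leNgt; apply/negP => hs.
by move: es; rewrite (energy_pinfty AA m0 nu0 sX theta0 hs) ltxx.
Qed.

Lemma le_fourier_spectrum_affine_cube (R : realType) k m (A : 'M[R]_(k, k + m)) b
    (c : R) (P : {finite_measure set (borel R (k + m)) -> \bar R}) (theta : R) :
  A *m A^T = 1%:M -> (0 < m)%N -> 0 <= theta <= 1 ->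
  is_affine_cube_measure A b c P ->
  ((k%:R * theta)%:E <= fourier_spectrum theta P)%E.
Proof.
move=> AA m0 /andP[theta0 theta1] hP.
have sp0 : (0 <= fourier_spectrum theta P)%E by apply: ereal_sup_ubound; left.
have [t0|tn0] := eqVneq theta 0; first by move: sp0; rewrite t0 mulr0.
have tp : 0 < theta by rewrite lt0r tn0.
have [M uM hM] := orthonormal_rows_completion AA.
have key s : 0 < s < k%:R * theta -> (s%:E <= fourier_spectrum theta P)%E.
  move=> /andP[s0 sk]; apply: ereal_sup_ubound; right; exists s => //.
  split; first exact: ltW.
  rewrite /energy (negbTE tn0); apply: poweR_lty; rewrite -lrVE.
  have -> : s / theta - (k + m)%:R = - ((k + m)%:R - s / theta) by rewrite opprB.
  (* Here a = (k + m) - s/theta: [m < a] amounts to s < k theta, and [a < k + m] to 0 < s. *)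
  apply: (@integral_powR_lty _ _ _ M _ `|c|) => //.
  - apply/andP; split; last by rewrite gtrBl divr_gt0.
    by rewrite natrD ltrBrDr addrC ltrD2r ltr_pdivrMr.
  - by rewrite ler_pdivlMr// ler_piMr.
  - by move=> z; rewrite /Normc.normc; case: (fourier _ _) => x y; exact: sqrtr_ge0.
  - move=> z; rewrite (normc_fourier_affine_cube z hP) normrM normr_prod.
    apply: ler_wpM2l => //; apply: ler_prod => i _; rewrite normr_ge0/= hM.
    exact: normr_sinc_le_max1.
(* Finite energy is known only for s strictly below k theta, so the endpoint is reached through k
   theta - e. *)
apply/lee_addgt0Pr => e e0.
have [kt|kt] := leP (k%:R * theta) e.
  by apply: (@le_trans _ _ e%:E); rewrite ?lee_fin// leeDr.
rewrite -leeBlDr//.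
have [ke0|ke0] := leP (k%:R * theta - e) 0.
  by apply: le_trans sp0; rewrite -EFinB lee_fin.
by rewrite -EFinB; apply: key; apply/andP; split=> //; rewrite gtrBl.
Qed.

Theorem corollary2p2 (R : realType) (k d : nat) (hk : (1 <= k)%N)
    (hkd : (k < d)%N) (X : set 'rV[R]_d)
    (hX : exists2 f : 'rV[R]_k -> 'rV[R]_d,
            isometric_on (@unit_cube R k) f & X = f @` @unit_cube R k)
    (theta : R) (htheta : 0 <= theta <= 1) :
  fourier_spectrum_set theta X = fourier_spectrum theta (hausdorff_restr k X)
  /\ fourier_spectrum theta (hausdorff_restr k X) = (k%:R * theta)%:E.
Proof.
have [m m0 dE] : exists2 m, (0 < m)%N & d = (k + m)%N.
  by exists (d - k)%N; rewrite ?subn_gt0// subnKC// ltnW.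
subst d; have [f fi XE] := hX.
have [b [A [AA fA]]] := isometric_affine fi.
have {}XE : X = [set b + x *m A | x in @unit_cube R k].
  by rewrite XE; apply/seteqP; split=> _ [x Qx <-]; exists x => //; rewrite fA.
have [c c0 [P PE hP]] := hausdorff_restr_measure b AA.
have /andP[theta0 theta1] := htheta.
have PX : (P : set _ -> \bar R) = hausdorff_restr k X by rewrite PE XE.
have PT : P setT != 0%E by rewrite (affine_cube_measure_setT hP) eqe gt_eqF.
have sP : spt P `<=` X.
  move=> x xP; apply: contrapT => xX.
  have oX : open (~` X) by apply: closed_openC; rewrite XE; exact: closed_affine_cube.
  have := xP _ oX xX.
  by rewrite PX /hausdorff_restr setICl outer_measure0 ltxx.
have spP : fourier_spectrum theta P = (k%:R * theta)%:E.
  apply/eqP; rewrite eq_le; apply/andP; split.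
    by apply: (fourier_spectrum_le AA m0 theta0 PT (b := b)); rewrite -XE.
  exact: (le_fourier_spectrum_affine_cube AA m0 htheta hP).
rewrite -PX spP; split => //.
apply/eqP; rewrite eq_le; apply/andP; split.
  apply: ge_ereal_sup => _ [nu [nu0 snu] <-].
  rewrite ge_min; apply/orP; left.
  by apply: (fourier_spectrum_le AA m0 theta0 nu0 (b := b)); rewrite -XE.
apply: ereal_sup_ubound; exists P => //.
(* The cap at the ambient dimension is inactive, as k theta <= k <= k + m. *)
rewrite spP min_l// lee_fin natrD.
apply: (@le_trans _ _ k%:R); first by rewrite ler_piMr.
by rewrite lerDl.
Qed.
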